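(* Let $(M^n,g,\phi,\lambda=0)$ be a manifold with density satisfying $\mathrm{Ric}=2\mu g$ and $\phi=c$ for constants $\mu,c\in\mathbb R$. Then its normal ambient metric $\widetilde g=2\,du\,dv+g_u$, $\widetilde\phi=\phi_u-v$ satisfies $$g_u=(1+4\mu u)\,g,\qquad \phi_u=\frac n4\ln|1+4\mu u|+c .$$ Moreover, for all $k\ge1$, $$v_{k,\phi}=\frac1{k!}\,\mu^k\prod_{j=0}^{k-1}(n-4j).$$
   Context: For a (pseudo-)Riemannian manifold of dimension $m$ with function $\phi$ and $\lambda\in\mathbb R$ put $P_\phi=\mathrm{Ric}+\nabla^2\phi-\lambda g$ and $F_\phi=\Delta\phi-|\nabla\phi|^2+2\lambda\phi-m\lambda$. Given $(M^n,g,\phi,\lambda)$, the normal weighted ambient metric is the structure on a neighborhood of $\{u=0\}$ in $\mathbb R_v\times M\times\mathbb R_u$ of the form $\widetilde g=2\,du\,dv+g_u$, $\widetilde\phi=\phi_u-v+\lambda uv$, where $(g_u,\phi_u)$ is a smooth one-parameter family of metrics and functions on $M$ with $(g_0,\phi_0)=(g,\phi)$, such that $\widetilde P_\phi=O(u^\infty)$ and $\widetilde F_\phi=O(u^\infty)$ at $u=0$ (computed for $(\widetilde g,\widetilde\phi,\lambda)$ with $m=n+2$). It is determined by $(g,\phi,\lambda)$ modulo $O(u^\infty)$, and equalities for it are understood modulo $O(u^\infty)$. The renormalized volume is $v_\phi=\dfrac{e^{-\widetilde\phi}}{e^{-\phi}}\left(\dfrac{\det g_u}{\det g}\right)^{1/2}$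 and the renormalized volume coefficients are $v_{k,\phi}=\frac1{k!}\partial_u^k v_\phi\big|_{u,v=0}$. *)

(* Defs.v *)
From HB Require Import structures.
From mathcomp Require Import all_boot all_order all_algebra.
From mathcomp Require Import all_classical all_reals all_analysis.

Set Implicit Arguments.
Unset Strict Implicit.
Unset Printing Implicit Defensive.

Import Order.TTheory GRing.Theory Num.Theory.
Import numFieldNormedType.Exports.

Local Open Scope classical_set_scope.
Local Open Scope ring_scope.

(* [smooth_on U f] is only meant for open U: every iterated directional
   derivative of f is (Frechet) differentiable at every point of U.  On a
   finite-dimensional V this is C^oo. *)
Definition smooth_on (R : realType) (V : normedModType R)
    (U : set V) (f : V -> R) : Prop :=
  forall (s : seq V) (x : V), U x ->
    differentiable (foldr (fun v h => 'D_v h) f s) x.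

Record chart (R : realType) (n : nat) (M : topologicalType) := Chart {
  cdom : set M;
  ccod : set 'rV[R]_n;
  cmap : M -> 'rV[R]_n;
  cinv : 'rV[R]_n -> M;
  cdom_open : open cdom;
  ccod_open : open ccod;
  cmap_cod : forall p, cdom p -> ccod (cmap p);
  cinv_dom : forall x, ccod x -> cdom (cinv x);
  cmapK : forall p, cdom p -> cinv (cmap p) = p;
  cinvK : forall x, ccod x -> cmap (cinv x) = x;
  cmap_cont : forall p, cdom p -> {for p, continuous cmap};
  cinv_cont : forall x, ccod x -> {for x, continuous cinv} }.

Definition transition (R : realType) (n : nat) (M : topologicalType)
    (c d : chart R n M) (x : 'rV[R]_n) : 'rV[R]_n := cmap d (cinv c x).

Definition overlap (R : realType) (n : nat) (M : topologicalType)
    (c d : chart R n M) : set 'rV[R]_n :=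
  [set x | ccod c x /\ cdom d (cinv c x)].

Record manifold (R : realType) (n : nat) := Manifold {
  points :> topologicalType;
  chart_index : Type;
  atlas : chart_index -> chart R n points;
  manifold_hausdorff : hausdorff_space points;
  manifold_second_countable : @second_countable points;
  atlas_cover : forall p : points, exists i, cdom (atlas i) p;
  atlas_smooth : forall (i j : chart_index) (a : 'I_n),
    smooth_on (overlap (atlas i) (atlas j))
      (fun x => transition (atlas i) (atlas j) x 0 a) }.

Section LocalFormulas.
Context {R : realType} {m : nat}.
Implicit Types (G : 'rV[R]_m -> 'M[R]_m) (f : 'rV[R]_m -> R) (x : 'rV[R]_m).

Definition partial (i : 'I_m) f : 'rV[R]_m -> R := 'D_(delta_mx 0 i) f.

(* Gamma^k_ij *)
Definition christoffel G (k i j : 'I_m) x : R :=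
  2^-1 * \sum_(l < m) invmx (G x) k l *
    (partial i (fun y => G y j l) x + partial j (fun y => G y i l) x
     - partial l (fun y => G y i j) x).

(* R^l_kij, the dx^l-component of R(e_i, e_j) e_k *)
Definition riemann G (l k i j : 'I_m) x : R :=
  partial i (christoffel G l j k) x - partial j (christoffel G l i k) x
  + \sum_(p < m) (christoffel G l i p x * christoffel G p j k x
                  - christoffel G l j p x * christoffel G p i k x).

(* The sign is such that round spheres have positive Ricci curvature. *)
Definition ricci G x : 'M[R]_m :=
  \matrix_(i, j) \sum_(k < m) riemann G k j k i x.

Definition hessian G f x : 'M[R]_m :=
  \matrix_(i, j) (partial i (partial j f) x
                  - \sum_(k < m) christoffel G k i j x * partial k f x).

Definition laplacian G f x : R :=
  \sum_(i < m) \sum_(j < m) invmx (G x) i j * hessian G f x i j.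

Definition gradsq G f x : R :=
  \sum_(i < m) \sum_(j < m) invmx (G x) i j * (partial i f x * partial j f x).

Definition weightedP G f (lambda : R) x : 'M[R]_m :=
  ricci G x + hessian G f x - lambda *: G x.

Definition weightedF G f (lambda : R) x : R :=
  laplacian G f x - gradsq G f x + 2 * lambda * f x - m%:R * lambda.

End LocalFormulas.

(* f = O(u^oo) along the part of {u = 0} lying in A, locally uniformly. *)
Definition Oinfty (R : realType) (T : topologicalType)
    (u : T -> R) (A : set T) (f : T -> R) : Prop :=
  forall p, A p -> u p = 0 -> forall k : nat,
    f =O_ (nbhs p) (fun q => u q ^+ k).

(* A covariant 2-tensor field on M is given by its matrix of components in
   each chart of the atlas; the values outside [ccod (atlas i)] are junk. *)
Definition tensor_field (R : realType) (n : nat) (M : manifold R n) : Type :=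
  chart_index M -> 'rV[R]_n -> 'M[R]_n.

(* [jacobian f x] acts on row vectors, so its (a, c) entry is the a-th
   partial derivative of the c-th component of f. *)
Definition tensor_compat (R : realType) (n : nat) (M : manifold R n)
    (g : tensor_field M) (i j : chart_index M) (x : 'rV[R]_n) : Prop :=
  let tau := transition (atlas i) (atlas j) in
  g i x = jacobian tau x *m g j (tau x) *m (jacobian tau x)^T.

(* Pseudo-Riemannian: symmetric and nondegenerate, of any signature. *)
Record is_metric (R : realType) (n : nat) (M : manifold R n)
    (g : tensor_field M) : Prop := IsMetric {
  metric_smooth : forall i a b,
    smooth_on (ccod (atlas i)) (fun x => g i x a b);
  metric_sym : forall i x, ccod (atlas i) x -> (g i x)^T = g i x;
  metric_nondeg : forall i x, ccod (atlas i) x -> g i x \in unitmx;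
  metric_compat : forall i j x,
    overlap (atlas i) (atlas j) x -> tensor_compat g i j x }.

(* The open set W of R_u * M, read in the chart i. *)
Definition chart_domain (R : realType) (n : nat) (M : manifold R n)
    (W : set (R * M)) (i : chart_index M) : set (R * 'rV[R]_n) :=
  [set q | ccod (atlas i) q.2 /\ W (q.1, cinv (atlas i) q.2)].

Record is_metric_family (R : realType) (n : nat) (M : manifold R n)
    (W : set (R * M)) (gu : R -> tensor_field M) : Prop := IsMetricFamily {
  family_smooth : forall i a b,
    smooth_on (chart_domain W i) (fun q => gu q.1 i q.2 a b);
  family_sym : forall i u x, chart_domain W i (u, x) ->
    (gu u i x)^T = gu u i x;
  family_nondeg : forall i u x, chart_domain W i (u, x) ->
    gu u i x \in unitmx;
  family_compat : forall i j u x, chart_domain W i (u, x) ->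
    overlap (atlas i) (atlas j) x -> tensor_compat (gu u) i j x }.

(* Coordinates (v, x, u) on R_v * M * R_u in the product of a chart of M with
   the identity charts of R. *)
Definition coord_v (R : realType) (n : nat) (y : 'rV[R]_(1 + (n + 1))) : R :=
  lsubmx y 0 0.
Definition coord_x (R : realType) (n : nat) (y : 'rV[R]_(1 + (n + 1)))
  : 'rV[R]_n := lsubmx (rsubmx y).
Definition coord_u (R : realType) (n : nat) (y : 'rV[R]_(1 + (n + 1))) : R :=
  rsubmx (rsubmx y) 0 0.

Section Ambient.
Context {R : realType} {n : nat} (M : manifold R n).
Implicit Types (g : tensor_field M) (phi : M -> R) (lambda : R)
  (W : set (R * M)) (gu : R -> tensor_field M) (phiu : R -> M -> R).

(* 2 du dv + g_u; each of the two off-diagonal entries is 1. *)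
Definition ambient_metric gu (i : chart_index M) (y : 'rV[R]_(1 + (n + 1)))
  : 'M[R]_(1 + (n + 1)) :=
  block_mx (0 : 'M[R]_(1, 1)) (row_mx (0 : 'M[R]_(1, n)) 1%:M)
           (col_mx (0 : 'M[R]_(n, 1)) 1%:M)
           (block_mx (gu (coord_u y) i (coord_x y)) 0 0 0).

Definition ambient_density phiu lambda (v : R) (p : M) (u : R) : R :=
  phiu u p - v + lambda * u * v.

Definition ambient_density_in phiu lambda (i : chart_index M)
    (y : 'rV[R]_(1 + (n + 1))) : R :=
  ambient_density phiu lambda (coord_v y) (cinv (atlas i) (coord_x y))
    (coord_u y).

(* The structure lives on the neighborhood {(v, p, u) | (u, p) \in W} of
   {u = 0}; by its form, g_u and phi_u do not depend on v. *)
Record is_normal_ambient g phi lambda W gu phiu : Prop := IsNormalAmbient {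
  ambient_open : open W;
  ambient_nbhd : forall p : M, W (0, p);
  ambient_family : is_metric_family W gu;
  ambient_smooth : forall i,
    smooth_on (chart_domain W i) (fun q => phiu q.1 (cinv (atlas i) q.2));
  ambient_g0 : forall i x, ccod (atlas i) x -> gu 0 i x = g i x;
  ambient_phi0 : forall p, phiu 0 p = phi p;
  ambient_P : forall i a b,
    Oinfty (@coord_u R n) [set y | ccod (atlas i) (coord_x y)]
      (fun y => weightedP (ambient_metric gu i)
                  (ambient_density_in phiu lambda i) lambda y a b);
  ambient_F : forall i,
    Oinfty (@coord_u R n) [set y | ccod (atlas i) (coord_x y)]
      (weightedF (ambient_metric gu i)
         (ambient_density_in phiu lambda i) lambda) }.

Definition metrics_eq_mod gu gu' : Prop :=
  forall i a b,
    Oinfty (fst : R * 'rV[R]_n -> R) [set q | ccod (atlas i) q.2]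
      (fun q => gu q.1 i q.2 a b - gu' q.1 i q.2 a b).

Definition densities_eq_mod phiu phiu' : Prop :=
  Oinfty (fst : R * M -> R) setT (fun q => phiu q.1 q.2 - phiu' q.1 q.2).

(* The quotient of determinants does not depend on the chart. *)
Definition renormalized_volume g phi lambda gu phiu (i : chart_index M)
    (v : R) (x : 'rV[R]_n) (u : R) : R :=
  let p := cinv (atlas i) x in
  expR (- ambient_density phiu lambda v p u) / expR (- phi p)
  * Num.sqrt (\det (gu u i x) / \det (g i x)).

Definition renormalized_volume_coef g phi lambda gu phiu (k : nat)
    (i : chart_index M) (x : 'rV[R]_n) : R :=
  (k`!%:R)^-1 * derive1n k (renormalized_volume g phi lambda gu phiu i 0 x) 0.

End Ambient.

(* Main.v *)
(* The ambient Ricci and Hessian tensors are computed in the coordinates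
   (v, x, u). Their tangential part and [F] read
     P_ij = Ric(g_u)_ij + (nabla^2 phi_u)_ij - 1/2 d_u (g_u)_ij,
     F = tr (nabla^2 phi_u - 1/2 d_u g_u) - |d phi_u|^2 + 2 d_u phi_u,
   so P = O(u^oo) and F = O(u^oo) express d_u g_u and d_u phi_u through
   derivatives of (g_u, phi_u) along M. Hence, by induction on k, any two
   solutions with the same values at u = 0 agree to order k along u = 0. Since
   Ric (s g) = Ric g for a constant s, the pair in the statement is an exact
   solution where 1 + 4 mu u > 0; its renormalized volume is
   (1 + 4 mu u)^(n/4). *)
Require Import Defs.
From HB Require Import structures.
From mathcomp Require Import all_boot all_order all_algebra.
From mathcomp Require Import all_classical all_reals all_analysis.
From mathcomp Require Import ring lra.

Set Implicit Arguments.
Unset Strict Implicit.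
Unset Printing Implicit Defensive.

Import Order.TTheory GRing.Theory Num.Theory.
Import numFieldNormedType.Exports.

Local Open Scope classical_set_scope.
Local Open Scope ring_scope.

(** * Smooth functions on open sets *)

(** The obstacle is that an estimate [O(u^oo)] cannot be differentiated, while the induction on the
    order differentiates at every stage. The estimates on P and F are therefore turned into the
    vanishing of all u-derivatives along u = 0, by a Taylor argument on each u-line. The induction
    then runs on congruences: two smooth functions are congruent to order k when their u-derivatives
    of order below k agree on the slice. Sums, products, inverses, [expR], [ln] and derivatives
    along M keep the order, the last because directional derivatives commute. At the end the mean
    value theorem turns congruence to all orders back into [O(u^oo)]. Uniqueness consults only the
    tangential part of P and F; that the explicit pair is a solution requires every component of P,
    including the mixed and the uu ones. The renormalized volume is compared as the exponential of a
    sum containing half a logarithm, so the work takes place on an open set where the ratio of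
    determinants is positive. *)

Section SmoothFunctions.
Context {R : realType} {V : normedModType R} {U : set V}.
Hypothesis oU : open U.
Implicit Types (f g : V -> R) (v w x : V).

Lemma eq_on_derive f g v x :
  (forall y, U y -> f y = g y) -> U x -> 'D_v f x = 'D_v g x.
Proof.
move=> fg Ux; apply: near_eq_derive.
by near=> y; apply: fg; near: y; exact: open_nbhs_nbhs.
Unshelve. all: by end_near. Qed.

Lemma eq_on_differentiable f g x :
  (forall y, U y -> f y = g y) -> U x -> differentiable f x ->
  differentiable g x.
Proof.
move=> fg Ux /diff_locallyP[dc df].
have nfg : \near x, f x = g x.
  by near=> y; apply: fg; near: y; exact: open_nbhs_nbhs.
have dg : g \o shift x = cst (g x) + 'd f x +o_ 0 id.
  apply/eqaddoP => _/posnumP[e]; move/eqaddoP: df => /(_ e%:num) /(_ [gt0 of e%:num]).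
  move: nfg; rewrite (near_shift 0) subr0 => nfg.
  apply: filterS2 nfg => h /= fgh.
  by rewrite !fctE /= fgh (fg _ Ux).
have dgE : 'd g x = 'd f x :> (V -> R) by exact: diff_unique.
by apply/diff_locallyP; rewrite dgE.
Unshelve. all: by end_near. Qed.

(* [smooth_on] applies further derivatives on the outside; unfolding them from the
   inside makes the product, quotient and chain rules inductive. *)
Fixpoint smooth_upto (k : nat) f : Prop :=
  (forall x, U x -> differentiable f x) /\
  (if k is k'.+1 then forall v, smooth_upto k' ('D_v f) else True).

Lemma smooth_onP f : smooth_on U f <-> forall k, smooth_upto k f.
Proof.
split=> [sf k|sf s].
  elim: k f sf => [|k IH] f sf; split=> //; try by move=> x; exact: (sf [::]).
  move=> v; apply: IH => s x Ux.
  by have := sf (rcons s v) x Ux; rewrite foldr_rcons.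
elim/last_ind: s f sf => [|s v IH] f sf x Ux; first by have [+ _] := sf 0%N; apply.
rewrite foldr_rcons; apply: IH => // k.
by have [_] := sf k.+1; apply.
Qed.


Lemma smooth_upto_eq k f g :
  (forall x, U x -> f x = g x) -> smooth_upto k f -> smooth_upto k g.
Proof.
elim: k f g => [|k IH] f g fg [df sf]; split=> //.
- by move=> x Ux; apply: eq_on_differentiable (df x Ux).
- by move=> x Ux; apply: eq_on_differentiable (df x Ux).
- by move=> v; apply: IH (sf v) => x Ux; exact: eq_on_derive.
Qed.

Lemma smooth_uptoW k f : smooth_upto k.+1 f -> smooth_upto k f.
Proof.
elim: k f => [|k IH] f [df sf]; split=> // v.
exact/IH/sf.
Qed.

Lemma smooth_upto_cst k (a : R) : smooth_upto k (cst a).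
Proof.
elim: k a => [|k IH] a; split=> // v.
by apply: smooth_upto_eq (IH 0) => x _; rewrite derive_cst.
Qed.

Lemma smooth_uptoD k f g :
  smooth_upto k f -> smooth_upto k g -> smooth_upto k (f \+ g).
Proof.
elim: k f g => [|k IH] f g [df sf] [dg sg]; split=> //.
- by move=> x Ux; apply: differentiableD; [exact: df|exact: dg].
- by move=> x Ux; apply: differentiableD; [exact: df|exact: dg].
- move=> v; apply: smooth_upto_eq (IH _ _ (sf v) (sg v)) => x Ux.
  by rewrite deriveD //; apply: diff_derivable; [exact: df|exact: dg].
Qed.

Lemma smooth_uptoM k f g :
  smooth_upto k f -> smooth_upto k g -> smooth_upto k (f \* g).
Proof.
elim: k f g => [|k IH] f g sf sg; have [df Df] := sf; have [dg Dg] := sg;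
  split=> //.
- by move=> x Ux; apply: differentiableM; [exact: df|exact: dg].
- by move=> x Ux; apply: differentiableM; [exact: df|exact: dg].
- move=> v; apply: (@smooth_upto_eq _ (f \* 'D_v g \+ g \* 'D_v f)).
    move=> x Ux; rewrite deriveM //=; apply: diff_derivable.
      exact: df.
    exact: dg.
  have [sf' sg'] := (smooth_uptoW sf, smooth_uptoW sg).
  by apply: smooth_uptoD; apply: IH => //; [exact: (Dg v)|exact: (Df v)].
Qed.

(** The derivative of 1/f is a product of -1, 1/f, 1/f and ['D_v f], so order k of the inverse
    yields order k+1. The exponential recurs in the same way, and the derivative of the logarithm
    reduces to an inverse. *)
Lemma smooth_uptoV k f : (forall x, U x -> f x != 0) ->
  smooth_upto k f -> smooth_upto k (fun x => (f x)^-1).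
Proof.
move=> f0; elim: k => [|k IH] sf; have [df Df] := sf; split=> //.
- by move=> x Ux; apply: differentiableV; [exact: df|exact: f0].
- by move=> x Ux; apply: differentiableV; [exact: df|exact: f0].
- move=> v; have sV := IH (smooth_uptoW sf).
  apply: (@smooth_upto_eq _
    (cst (-1) \* ((fun x => (f x)^-1) \* (fun x => (f x)^-1) \* 'D_v f))).
    move=> x Ux; rewrite deriveV; [|exact: f0|exact/diff_derivable/df].
    rewrite /GRing.scale /=; by field; exact: f0.
  apply: smooth_uptoM; first exact: smooth_upto_cst.
  by apply: smooth_uptoM; [exact: smooth_uptoM|exact: (Df v)].
Qed.


Lemma derive_chain (F : R -> R) f dF x v :
  is_derive (f x) 1 F dF -> differentiable f x ->
  'D_v (fun y => F (f y)) x = dF * 'D_v f x.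
Proof.
move=> [/derivable1_diffP DF <-] df.
rewrite deriveE; last exact: differentiable_comp.
rewrite -[fun y => _]/(F \o f) diff_comp //= deriv1E ?derive1E.
  by rewrite [in RHS](deriveE _ df) mulrC.
exact/derivable1_diffP.
Qed.

Lemma smooth_upto_expR k f :
  smooth_upto k f -> smooth_upto k (fun x => expR (f x)).
Proof.
elim: k => [|k IH] sf; have [df Df] := sf.
  split=> // x Ux; apply: differentiable_comp; first exact: df.
  exact/derivable1_diffP/derivable_expR.
split.
  move=> x Ux; apply: differentiable_comp; first exact: df.
  exact/derivable1_diffP/derivable_expR.
move=> v; apply: (@smooth_upto_eq _ ((fun x => expR (f x)) \* 'D_v f)).
  move=> x Ux; rewrite (derive_chain _ (is_derive_expR _)) //; exact: df.
by apply: smooth_uptoM; [exact/IH/smooth_uptoW|exact: (Df v)].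
Qed.

Lemma smooth_upto_ln k f : (forall x, U x -> 0 < f x) ->
  smooth_upto k f -> smooth_upto k (fun x => ln (f x)).
Proof.
move=> f0 sf.
have dl x : U x -> differentiable (fun x => ln (f x)) x.
  move=> Ux; apply: differentiable_comp; first by case: k sf => [|k] [df _]; exact: df.
  by apply/derivable1_diffP; have [] := is_derive1_ln (f0 x Ux).
case: k sf => [|k] sf; split=> // v; have [df Df] := sf.
apply: (@smooth_upto_eq _ ((fun x => (f x)^-1) \* 'D_v f)).
  move=> x Ux; rewrite (derive_chain _ (is_derive1_ln (f0 x Ux))) //; exact: df.
apply: smooth_uptoM; last exact: (Df v).
by apply: smooth_uptoV; [move=> x Ux; rewrite gt_eqF ?f0|exact: smooth_uptoW].
Qed.

Lemma smooth_on_differentiable f x : smooth_on U f -> U x -> differentiable f x.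
Proof. by move=> sf; exact: (sf [::]). Qed.

Lemma smooth_on_derivable f x v : smooth_on U f -> U x -> derivable f x v.
Proof. by move=> sf Ux; exact/diff_derivable/smooth_on_differentiable. Qed.

Lemma smooth_on_eq f g :
  (forall x, U x -> f x = g x) -> smooth_on U f -> smooth_on U g.
Proof.
by move=> fg /smooth_onP sf; apply/smooth_onP => k; exact: smooth_upto_eq (sf k).
Qed.

Lemma smooth_on_cst (a : R) : smooth_on U (cst a).
Proof. by apply/smooth_onP => k; exact: smooth_upto_cst. Qed.

Lemma smooth_onD f g :
  smooth_on U f -> smooth_on U g -> smooth_on U (fun x => f x + g x).
Proof.
move=> /smooth_onP sf /smooth_onP sg.
by apply/smooth_onP => k; exact: smooth_uptoD.
Qed.

Lemma smooth_onM f g :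
  smooth_on U f -> smooth_on U g -> smooth_on U (fun x => f x * g x).
Proof.
move=> /smooth_onP sf /smooth_onP sg.
by apply/smooth_onP => k; exact: smooth_uptoM.
Qed.

Lemma smooth_onV f : (forall x, U x -> f x != 0) ->
  smooth_on U f -> smooth_on U (fun x => (f x)^-1).
Proof.
by move=> f0 /smooth_onP sf; apply/smooth_onP => k; exact: smooth_uptoV.
Qed.

Lemma smooth_on_expR f : smooth_on U f -> smooth_on U (fun x => expR (f x)).
Proof.
by move=> /smooth_onP sf; apply/smooth_onP => k; exact: smooth_upto_expR.
Qed.

Lemma smooth_on_ln f : (forall x, U x -> 0 < f x) ->
  smooth_on U f -> smooth_on U (fun x => ln (f x)).
Proof.
by move=> f0 /smooth_onP sf; apply/smooth_onP => k; exact: smooth_upto_ln f0 (sf k).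
Qed.

Lemma smooth_on_derive f v : smooth_on U f -> smooth_on U ('D_v f).
Proof.
by move=> sf s x Ux; have := sf (rcons s v) x Ux; rewrite foldr_rcons.
Qed.

Lemma smooth_on_linear f : linear f -> (forall x, differentiable f x) ->
  smooth_on U f.
Proof.
move=> lf df; have f0 : f 0 = 0.
  by have := lf (-1) 0 0; rewrite scaleN1r oppr0 add0r scaleN1r addNr.
have Df v x : 'D_v f x = f v.
  apply: cvg_lim => //; apply: (@cvg_near_cst _ _ (f v)).
  near=> h; rewrite /= lf addrK scalerA mulVf ?scale1r //.
  by near: h; exact: nbhs_dnbhs_neq.
apply/smooth_onP => -[|k]; split=> // v.
by apply: (@smooth_upto_eq _ (cst (f v))) => [x _|]; [rewrite Df|exact: smooth_upto_cst].
Unshelve. all: by end_near. Qed.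

End SmoothFunctions.

(** * Composition with affine maps *)

Section AffineChange.
Context {R : realType} {V W : normedModType R} (L L0 : V -> W).
Hypothesis affL : forall a x y, L (a *: x + y) = a *: L0 x + L y.
Hypothesis dL : forall x, differentiable L x.

(** [L] is affine with linear part [L0], so the two difference quotients coincide before any limit
    is taken, for an arbitrary [f]. This serves the projections to u and x as well as parametrized
    lines. *)
Lemma derive_comp_affine (f : W -> R) v x :
  'D_v (fun y => f (L y)) x = 'D_(L0 v) f (L x).
Proof.
rewrite /derive; set p := fun h => _; set q := fun h => _.
by suff -> : p = q by []; apply/funext => h; rewrite /p /q /= affL.
Qed.

Lemma smooth_on_comp_affine (U : set W) (f : W -> R) :
  smooth_on U f -> smooth_on (L @^-1` U) (fun x => f (L x)).
Proof.
move=> sf s x Ux.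
have -> : foldr (fun v h => 'D_v h) (fun x => f (L x)) s =
    (fun x => foldr (fun v h => 'D_v h) f (map L0 s) (L x)).
  by elim: s => //= v s ->; apply/funext => y; rewrite derive_comp_affine.
by apply: differentiable_comp; [exact: dL|exact: (sf (map L0 s) (L x) Ux)].
Qed.

End AffineChange.

Lemma smooth_on_subset (R : realType) (V : normedModType R) (A B : set V)
  (f : V -> R) : A `<=` B -> smooth_on B f -> smooth_on A f.
Proof. by move=> AB sf s x Ax; exact/sf/AB. Qed.

(** * Mean values on lines and symmetry of second derivatives *)

Section Lines.
Context {R : realType} {V : normedModType R}.
Implicit Types (f : V -> R) (x v w : V).

Lemma is_derive_line f x v (t : R) : derivable f (x + t *: v) v ->
  is_derive t 1 (fun s : R => f (x + s *: v)) ('D_v f (x + t *: v)).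
Proof.
rewrite /derivable => df.
have E : (fun h : R => h^-1 *: (((fun s : R => f (x + s *: v)) \o shift t) (h *: 1)
     - (fun s : R => f (x + s *: v)) t)) =
   (fun h : R => h^-1 *: ((f \o shift (x + t *: v)) (h *: v) - f (x + t *: v))).
  apply/funext => h /=; rewrite [h%:A]mulr1 scalerDl addrCA; congr (_ *: (f _ - _)).
by apply: DeriveDef; rewrite /derivable /derive E.
Qed.

Lemma MVT_line f x v (h : R) : 0 < h ->
  (forall t, 0 <= t <= h -> differentiable f (x + t *: v)) ->
  exists2 t, 0 <= t <= h & f (x + h *: v) - f x = h * 'D_v f (x + t *: v).
Proof.
move=> h0 df.
have [||t] := @MVT _ (fun s : R => f (x + s *: v))
    (fun s => 'D_v f (x + s *: v)) _ _ h0.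
- move=> t; rewrite in_itv /= => /andP[t0 th].
  by apply/is_derive_line/diff_derivable/df; rewrite !ltW.
- apply: derivable_within_continuous => t; rewrite in_itv /= => /df dt.
  by have [] := is_derive_line (@diff_derivable _ _ _ _ _ v dt).
- rewrite in_itv /= => /andP[t0 th] E; exists t; first by rewrite !ltW.
  by move: E; rewrite scale0r addr0 subr0 mulrC.
Qed.

Lemma continuous_ball f x (e : R) : {for x, continuous f} -> 0 < e ->
  exists2 d : R, 0 < d & forall y, ball x d y -> `|f x - f y| < e.
Proof.
move=> /cvgr_dist_lt fx e0.
by have /nbhs_ballP[d d0 dP] := fx e e0; exists d.
Qed.

(** Two applications of the mean value theorem: along [v] to the increment y |-> f (y + h w) - f y,
    then along [w] to ['D_v f]. *)
Lemma second_difference (U : set V) f x v w (h : R) : smooth_on U f -> 0 < h ->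
  (forall s t, 0 <= s <= h -> 0 <= t <= h -> U (x + s *: v + t *: w)) ->
  exists s t, [/\ 0 <= s <= h, 0 <= t <= h &
    f (x + h *: v + h *: w) - f (x + h *: v) - (f (x + h *: w) - f x) =
    h * (h * 'D_w ('D_v f) (x + s *: v + t *: w))].
Proof.
move=> sf h0 Ux.
have h1 : 0 <= h <= h by rewrite lexx ltW.
have h2 : (0 : R) <= 0 <= h by rewrite lexx ltW.
pose F y := f (y + h *: w) - f y.
have dF t : 0 <= t <= h -> differentiable (fun y => f (y + h *: w)) (x + t *: v).
  move=> th; apply: differentiable_comp; last exact: (sf [::] _ (Ux _ _ th h1)).
  exact: differentiableD (differentiable_cst _ _).
have df t : 0 <= t <= h -> differentiable f (x + t *: v).
  by move=> th; have := Ux _ _ th h2; rewrite scale0r addr0; exact: (sf [::]).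
have [t th|s sh Es] := @MVT_line F x v h h0.
  exact: differentiableB (dF t th) (df t th).
have [t th|t th Et] := @MVT_line ('D_v f) (x + s *: v) w h h0.
  exact: (sf [:: v] _ (Ux _ _ sh th)).
exists s, t; split=> //; rewrite -Et -[LHS]/(F (x + h *: v) - F x) Es; congr (_ * _).
rewrite /F deriveB; [|exact/diff_derivable/dF|exact/diff_derivable/df].
congr (_ - _); rewrite /derive; set p := fun h => _; set q := fun h => _.
by suff -> : p = q by []; apply/funext => r; rewrite /p /q /= -[r *: v + _ + _]addrA.
Qed.

(** The second difference over a parallelogram is symmetric in [v] and [w], so the two mixed
    derivatives take a common value at two points of a small parallelogram. By continuity their
    values at [x] differ by at most any [e]. *)
Lemma derive_comm (U : set V) f x v w : open U -> smooth_on U f -> U x ->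
  'D_v ('D_w f) x = 'D_w ('D_v f) x.
Proof.
move=> oU sf Ux; apply/eqP; rewrite -subr_eq0 -normr_le0; apply/ler_addgt0Pr => e e0.
have e2 : 0 < e / 2 by rewrite divr_gt0.
have close (a b c : R) : `|a - c| < e / 2 -> `|b - c| < e / 2 -> `|a - b| <= e.
  move=> ac bc; rewrite (_ : a - b = (a - c) - (b - c)); last by ring.
  by rewrite (le_trans (ler_normB _ _)) //; lra.
have [d d0 dP] : exists2 d, 0 < d & forall y, ball x d y ->
    [/\ U y, `|'D_v ('D_w f) x - 'D_v ('D_w f) y| < e / 2 &
             `|'D_w ('D_v f) x - 'D_w ('D_v f) y| < e / 2].
  have cvw : {for x, continuous ('D_v ('D_w f))}.
    exact/differentiable_continuous/(sf [:: v; w] _ Ux).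
  have cwv : {for x, continuous ('D_w ('D_v f))}.
    exact/differentiable_continuous/(sf [:: w; v] _ Ux).
  have /nbhs_ballP[d1 d10 U1] : nbhs x U by exact: open_nbhs_nbhs.
  have [d2 d20 U2] := continuous_ball cvw e2.
  have [d3 d30 U3] := continuous_ball cwv e2.
  exists (Num.min d1 (Num.min d2 d3)); first by rewrite lt_min d10 lt_min d20.
  move=> y yd; split; [apply: U1|apply: U2|apply: U3];
    by apply: le_ball yd; rewrite !ge_min lexx ?orbT.
(* This makes h (|v| + |w|) < d, so the parallelogram stays in the ball; the summand 1 keeps the
   denominator positive when both directions vanish. *)
pose h := d / (1 + `|v| + `|w|) / 2.
have s0 : 0 < 1 + `|v| + `|w| by rewrite ltr_pwDl ?ltr_pwDl.
have h0 : 0 < h by apply: divr_gt0 => //; exact: divr_gt0.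
have inb s t : 0 <= s <= h -> 0 <= t <= h -> ball x d (x + s *: v + t *: w).
  move=> /andP[s1 sh] /andP[t1 th]; rewrite -ball_normE /=.
  have -> : x - (x + s *: v + t *: w) = - (s *: v + t *: w).
    by rewrite -addrA opprD addrA subrr sub0r.
  rewrite normrN.
  rewrite (le_lt_trans (ler_normD _ _)) // !normrZ !ger0_norm //.
  rewrite (@le_lt_trans _ _ (h * (1 + `|v| + `|w|))) //.
    rewrite !mulrDr mulr1 -addrA -[leLHS]add0r.
    by apply: lerD; [exact: ltW|apply: lerD; exact: ler_wpM2r].
  by rewrite /h mulrAC divfK ?gt_eqF // ltr_pdivrMr // ltr_pMr // ltrDl.
have Ub s t : 0 <= s <= h -> 0 <= t <= h -> U (x + s *: v + t *: w).
  by move=> sh th; have [] := dP _ (inb _ _ sh th).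
have [s [t [sh th E]]] := second_difference sf h0 Ub.
(* The same second difference with the roles of [v] and [w] exchanged. *)
have [s' t' s'h t'h|t' [s' [t'h s'h E']]] := @second_difference U f x w v h sf h0.
  by rewrite addrAC; exact: Ub.
have swap (a b c d' : R) : a - b - (c - d') = a - c - (b - d') by ring.
have hn : h != 0 by rewrite gt_eqF.
have {E'}E : 'D_w ('D_v f) (x + s *: v + t *: w) = 'D_v ('D_w f) (x + t' *: w + s' *: v).
  move: E E'; rewrite [x + h *: w + h *: v]addrAC swap => -> /(mulfI hn) /(mulfI hn).
  by [].
have [_ _ bE] := dP _ (inb _ _ sh th); have := inb _ _ s'h t'h.
rewrite addrAC => /dP[_ aE _]; rewrite add0r; apply: close aE _.
by rewrite -E.
Qed.

End Lines.

(** * Jets along a hyperplane *)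

Section Jets.
Context {R : realType} {V : normedModType R} (U : set V).
Context (u : V -> R) (e : V).
Hypotheses (oU : open U) (linu : linear u) (du : forall x, differentiable u x).
Hypothesis ue : u e = 1.
Implicit Types (f g h : V -> R) (v w x y : V).

Let uD x y : u (x + y) = u x + u y.
Proof. by rewrite -[x]scale1r linu !scale1r. Qed.

Let uZ a x : u (a *: x) = a * u x.
Proof.
have u0 : u 0 = 0.
  by have := linu (-1) 0 0; rewrite scaleN1r oppr0 add0r scaleN1r addNr.
by rewrite -[a *: x]addr0 linu u0 addr0.
Qed.

(** Congruence modulo u^k: normal derivatives of order 0 to k - 1 agree on the slice, and order 0
    imposes nothing. Peeling off the innermost ['D_e] lets the Leibniz and chain rules feed the
    induction. *)
Fixpoint jet_eq (k : nat) f g : Prop :=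
  if k is k'.+1 then
    (forall x, U x -> u x = 0 -> f x = g x) /\ jet_eq k' ('D_e f) ('D_e g)
  else True.

Lemma jet_eqP k f g : jet_eq k f g <->
  forall j, (j < k)%N -> forall x, U x -> u x = 0 ->
    iter j (fun h => 'D_e h) f x = iter j (fun h => 'D_e h) g x.
Proof.
elim: k f g => [|k IH] f g; first by split.
split=> [[fg /IH jfg] [|j] jk x Ux u0|jfg].
- exact: fg.
- by rewrite !iterSr; exact: jfg.
split; first by move=> x; exact: (jfg 0%N).
by apply/IH => j jk x; rewrite -!iterSr; exact: (jfg j.+1).
Qed.

Lemma jet_eq_refl k f : jet_eq k f f.
Proof. by elim: k f => //= k IH f; split. Qed.

Lemma jet_eqW k f g : jet_eq k.+1 f g -> jet_eq k f g.
Proof. by elim: k f g => //= k IH f g [fg] /IH. Qed.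

Lemma jet_eq_on k f g f' g' : (forall x, U x -> f x = f' x) ->
  (forall x, U x -> g x = g' x) -> jet_eq k f g -> jet_eq k f' g'.
Proof.
elim: k f g f' g' => //= k IH f g f' g' ff gg [fg jfg]; split.
  by move=> x Ux u0; rewrite -ff // -gg // fg.
by apply: IH jfg => x Ux; exact: (eq_on_derive oU).
Qed.

Lemma jet_eqD k f g f' g' :
  smooth_on U f -> smooth_on U g -> smooth_on U f' -> smooth_on U g' ->
  jet_eq k f f' -> jet_eq k g g' ->
  jet_eq k (fun x => f x + g x) (fun x => f' x + g' x).
Proof.
elim: k f g f' g' => //= k IH f g f' g' sf sg sf' sg' [ff jf] [gg jg]; split.
  by move=> x Ux u0; rewrite ff // gg.
have := IH _ _ _ _ (smooth_on_derive e sf) (smooth_on_derive e sg)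
  (smooth_on_derive e sf') (smooth_on_derive e sg') jf jg.
by apply: jet_eq_on => x Ux; rewrite deriveD //; exact: (@smooth_on_derivable _ _ U).
Qed.

Lemma jet_eqM k f g f' g' :
  smooth_on U f -> smooth_on U g -> smooth_on U f' -> smooth_on U g' ->
  jet_eq k f f' -> jet_eq k g g' ->
  jet_eq k (fun x => f x * g x) (fun x => f' x * g' x).
Proof.
elim: k f g f' g' => //= k IH f g f' g' sf sg sf' sg' jff jgg.
have [ff jf] := jff; have [gg jg] := jgg; split.
  by move=> x Ux u0; rewrite ff // gg.
have jff' := jet_eqW jff; have jgg' := jet_eqW jgg.
have [Df Dg] := (smooth_on_derive e sf, smooth_on_derive e sg).
have [Df' Dg'] := (smooth_on_derive e sf', smooth_on_derive e sg').
apply: (@jet_eq_on _ (fun x => f x * 'D_e g x + g x * 'D_e f x)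
                     (fun x => f' x * 'D_e g' x + g' x * 'D_e f' x)).
- by move=> x Ux; rewrite deriveM //; exact: (@smooth_on_derivable _ _ U).
- by move=> x Ux; rewrite deriveM //; exact: (@smooth_on_derivable _ _ U).
- by apply: jet_eqD; [exact: smooth_onM..|exact: IH|exact: IH].
Qed.

(* On the slice itself because it is invariant under translation by w, to higher
   order because ['D_w] and ['D_e] commute. *)
Lemma jet_eq_derive k f g w : u w = 0 -> smooth_on U f -> smooth_on U g ->
  jet_eq k f g -> jet_eq k ('D_w f) ('D_w g).
Proof.
move=> w0; elim: k f g => //= k IH f g sf sg [fg jfg]; split.
  move=> x Ux u0; rewrite /derive; congr (lim _).
  have : nbhs (0 : R) [set h | U (h *: w + x)].
    have : {for 0, continuous (fun h : R => h *: w + x)}.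
      apply: differentiable_continuous.
      exact: differentiableD (differentiableZl w (@ex_diff _ _ _ _ _ idfun _ _))
        (differentiable_cst _ _).
    by apply; rewrite scale0r add0r; exact: open_nbhs_nbhs.
  move=> nU; rewrite eqEsubset; split; apply/near_eq_cvg/cvg_within;
    apply: filterS nU => h Uh; rewrite /= !fg //; by rewrite uD uZ w0 mulr0 add0r.
have := IH _ _ (smooth_on_derive e sf) (smooth_on_derive e sg) jfg.
by apply: jet_eq_on => x Ux; exact: (derive_comm _ _ oU).
Qed.

(** Smoothness travels with the congruence because the Leibniz rule and the commutation of
    derivatives need it at every stage. *)
Definition cong (k : nat) f g := [/\ smooth_on U f, smooth_on U g & jet_eq k f g].

Lemma cong_refl k f : smooth_on U f -> cong k f f.
Proof. by move=> sf; split=> //; exact: jet_eq_refl. Qed.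

Lemma cong_cst k (a : R) : cong k (cst a) (cst a).
Proof. by apply/cong_refl/smooth_on_cst. Qed.

Lemma cong_on k f g f' g' : (forall x, U x -> f x = f' x) ->
  (forall x, U x -> g x = g' x) -> cong k f g -> cong k f' g'.
Proof.
move=> ff gg [sf sg jfg].
by split; [exact: smooth_on_eq sf|exact: smooth_on_eq sg|exact: jet_eq_on jfg].
Qed.

Lemma congW k f g : cong k.+1 f g -> cong k f g.
Proof. by move=> [sf sg jfg]; split=> //; exact: jet_eqW. Qed.

Lemma congD k f g f' g' : cong k f f' -> cong k g g' ->
  cong k (fun x => f x + g x) (fun x => f' x + g' x).
Proof.
move=> [sf sf' jf] [sg sg' jg].
by split; [exact: smooth_onD|exact: smooth_onD|exact: jet_eqD].
Qed.

Lemma congM k f g f' g' : cong k f f' -> cong k g g' ->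
  cong k (fun x => f x * g x) (fun x => f' x * g' x).
Proof.
move=> [sf sf' jf] [sg sg' jg].
by split; [exact: smooth_onM|exact: smooth_onM|exact: jet_eqM].
Qed.

Lemma congN k f f' : cong k f f' -> cong k (fun x => - f x) (fun x => - f' x).
Proof.
move=> /(congM (cong_cst k (-1))).
by apply: cong_on => x _; rewrite mulN1r.
Qed.

Lemma congB k f g f' g' : cong k f f' -> cong k g g' ->
  cong k (fun x => f x - g x) (fun x => f' x - g' x).
Proof. by move=> cf /congN; exact: congD. Qed.

Lemma cong_sum (I : Type) (r : seq I) (P : pred I) k (f f' : I -> V -> R) :
  (forall i, cong k (f i) (f' i)) ->
  cong k (fun x => \sum_(i <- r | P i) f i x) (fun x => \sum_(i <- r | P i) f' i x).
Proof.
move=> cf; elim: r => [|i r IH].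
  by apply: cong_on (cong_cst k 0) => x _; rewrite big_nil.
case Pi : (P i).
  by apply: cong_on (congD (cf i) IH) => x _; rewrite big_cons Pi.
by apply: cong_on IH => x _; rewrite big_cons Pi.
Qed.

Lemma cong_prod (I : Type) (r : seq I) (P : pred I) k (f f' : I -> V -> R) :
  (forall i, cong k (f i) (f' i)) ->
  cong k (fun x => \prod_(i <- r | P i) f i x) (fun x => \prod_(i <- r | P i) f' i x).
Proof.
move=> cf; elim: r => [|i r IH].
  by apply: cong_on (cong_cst k 1) => x _; rewrite big_nil.
case Pi : (P i).
  by apply: cong_on (congM (cf i) IH) => x _; rewrite big_cons Pi.
by apply: cong_on IH => x _; rewrite big_cons Pi.
Qed.

Lemma congV k f g : (forall x, U x -> f x != 0) -> (forall x, U x -> g x != 0) ->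
  cong k f g -> cong k (fun x => (f x)^-1) (fun x => (g x)^-1).
Proof.
move=> f0 g0 [sf sg jfg].
have [sfV sgV] := (smooth_onV oU f0 sf, smooth_onV oU g0 sg).
split=> //; elim: k jfg => [|k IH] //= jfg; have [fg jfg'] := jfg; split.
  by move=> x Ux u0; rewrite fg.
have cV : cong k (fun x => (f x)^-1) (fun x => (g x)^-1).
  by split=> //; exact/IH/jet_eqW.
have cD : cong k ('D_e f) ('D_e g) by split=> //; exact: smooth_on_derive.
have [_ _] := congN (congM (congM cV cV) cD).
apply: jet_eq_on => x Ux; (rewrite deriveV; [|by auto|exact: (@smooth_on_derivable _ _ U)]);
  by rewrite /GRing.scale /=; field; auto.
Qed.

Lemma cong_expR k f g :
  cong k f g -> cong k (fun x => expR (f x)) (fun x => expR (g x)).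
Proof.
move=> [sf sg jfg].
have [sfV sgV] := (smooth_on_expR oU sf, smooth_on_expR oU sg).
split=> //; elim: k jfg => [|k IH] //= jfg; have [fg jfg'] := jfg; split.
  by move=> x Ux u0; rewrite fg.
have cV : cong k (fun x => expR (f x)) (fun x => expR (g x)).
  by split=> //; exact/IH/jet_eqW.
have cD : cong k ('D_e f) ('D_e g) by split=> //; exact: smooth_on_derive.
have [_ _] := congM cV cD.
by apply: jet_eq_on => x Ux; rewrite (derive_chain _ (is_derive_expR _)) //;
  exact: (@smooth_on_differentiable _ _ U).
Qed.

Lemma cong_ln k f g : (forall x, U x -> 0 < f x) -> (forall x, U x -> 0 < g x) ->
  cong k f g -> cong k (fun x => ln (f x)) (fun x => ln (g x)).
Proof.
move=> f0 g0 cfg; have [sf sg jfg] := cfg; split; try exact: smooth_on_ln.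
case: k jfg cfg => //= k [fg jfg] cfg; split.
  by move=> x Ux u0; rewrite fg.
have cD : cong k ('D_e f) ('D_e g) by split=> //; exact: smooth_on_derive.
have cV : cong k (fun x => (f x)^-1) (fun x => (g x)^-1).
  by apply: congV;
    [move=> x Ux; rewrite gt_eqF ?f0|move=> x Ux; rewrite gt_eqF ?g0|exact: congW].
have [_ _] := congM cV cD.
by apply: jet_eq_on => x Ux;
  [rewrite (derive_chain _ (is_derive1_ln (f0 x Ux))) //
  |rewrite (derive_chain _ (is_derive1_ln (g0 x Ux))) //];
  exact: (@smooth_on_differentiable _ _ U).
Qed.

Lemma cong_derive k f g w : u w = 0 -> cong k f g -> cong k ('D_w f) ('D_w g).
Proof.
move=> w0 [sf sg jfg].
by split; [exact: smooth_on_derive|exact: smooth_on_derive|exact: jet_eq_derive].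
Qed.

Lemma cong_det k m (A B : V -> 'M[R]_m) :
  (forall i j, cong k (fun x => A x i j) (fun x => B x i j)) ->
  cong k (fun x => \det (A x)) (fun x => \det (B x)).
Proof.
move=> AB; apply: cong_sum => s; apply: congM; first exact: cong_cst.
by apply: cong_prod => i; exact: AB.
Qed.

(** By Cramer's rule the entries of the inverse are cofactors over the determinant, hence are built
    by sums, products and one scalar inverse. *)
Lemma cong_invmx k m (A B : V -> 'M[R]_m) i j :
  (forall x, U x -> A x \in unitmx) -> (forall x, U x -> B x \in unitmx) ->
  (forall i j, cong k (fun x => A x i j) (fun x => B x i j)) ->
  cong k (fun x => invmx (A x) i j) (fun x => invmx (B x) i j).
Proof.
move=> Au Bu AB.
have nz (C : V -> 'M[R]_m) : (forall x, U x -> C x \in unitmx) ->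
    forall x, U x -> \det (C x) != 0.
  by move=> Cu x /Cu; rewrite unitmxE unitfE.
apply: (@cong_on _ (fun x => (\det (A x))^-1 * cofactor (A x) j i)
                   (fun x => (\det (B x))^-1 * cofactor (B x) j i)).
- by move=> x Ux; rewrite /invmx Au // !mxE.
- by move=> x Ux; rewrite /invmx Bu // !mxE.
apply: congM; first by apply: congV; [exact: nz|exact: nz|exact: cong_det].
apply: congM; first exact: cong_cst.
apply: cong_det => a b.
by apply: cong_on (AB (lift j a) (lift i b)) => x _; rewrite !mxE.
Qed.

(** The only place where an order is gained: an equation for the normal derivative to order k, with
    equal values on the slice, gives order k+1. *)
Lemma congS k f g : smooth_on U f -> smooth_on U g ->
  (forall x, U x -> u x = 0 -> f x = g x) -> cong k ('D_e f) ('D_e g) ->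
  cong k.+1 f g.
Proof. by move=> sf sg fg [_ _ jfg]; split. Qed.

End Jets.

(** * Vanishing jets versus growth estimates *)

Section JetsBigO.
Context {R : realType} {V : normedModType R} (U : set V).
Context (u : V -> R) (e : V).
Hypotheses (oU : open U) (linu : linear u) (du : forall x, differentiable u x).
Hypothesis ue : u e = 1.
Implicit Types (f g h : V -> R) (x p q : V).

(** Projecting q along [e] to the slice, where [h] vanishes, the mean value theorem gives h q = u q
    times ['D_e h y] with y on the segment. There u y = t (u q) with t in [0, 1], so the bound of
    order k on ['D_e h] gains one factor u q. *)
Lemma jet0_bigO k h p : smooth_on U h -> jet_eq U u e k h (cst 0) ->
  U p -> u p = 0 ->
  exists2 C, 0 < C & \forall q \near p, `|h q| <= C * `|u q ^+ k|.
Proof.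
have u0 : u 0 = 0 by have := linu (-1) 0 0; rewrite scaleN1r oppr0 add0r scaleN1r addNr.
have uZ a x : u (a *: x) = a * u x by rewrite -[a *: x]addr0 linu u0 addr0.
elim: k h p => [|k IH] h p sh jh Up up.
  exists (`|h p| + 1); first by rewrite ltr_wpDl.
  have /cvgr_dist_lt/(_ 1 ltr01) := differentiable_continuous (sh [::] p Up).
  apply: filterS => q /= hq; rewrite expr0 normr1 mulr1 -lerBlDl.
  by rewrite (le_trans (lerB_dist _ _)) // distrC ltW.
have [h0 jDh] := jh.
have jDh0 : jet_eq U u e k ('D_e h) (cst 0).
  by apply: (jet_eq_on oU _ _ jDh) => // x _; rewrite derive_cst.
have [C C0 /nbhs_ballP[d d0 dP]] := IH _ p (smooth_on_derive e sh) jDh0 Up up.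
have /nbhs_ballP[d' d'0 d'P] : nbhs p U by exact: open_nbhs_nbhs.
(* Half of [r] is allotted to the distance from p to q and half to the length of u q e, so the whole
   segment from the projection to q lies in the ball of radius [r]. *)
pose r := Num.min d d'.
have r0 : 0 < r / 2 by rewrite divr_gt0 // lt_min d0.
exists C => //.
have cue : {for p, continuous (fun q => u q *: e)}.
  exact/differentiable_continuous/differentiableZl/du.
have nue : \forall q \near p, `|u q *: e| < r / 2.
  have /cvgr_dist_lt/(_ _ r0) := cue.
  by apply: filterS => q /=; rewrite up scale0r sub0r normrN.
have nr : \forall q \near p, ball p (r / 2) q by exact: nbhsx_ballx.
apply: filterS2 nue nr => q ueq pq.
have inb t : 0 <= t <= 1 -> ball p r (q - u q *: e + t *: (u q *: e)).
  move=> /andP[t0 t1]; move: pq; rewrite -!ball_normE /= => pq.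
  have -> : p - (q - u q *: e + t *: (u q *: e)) = (p - q) + (1 - t) *: (u q *: e).
    by rewrite scalerBl scale1r !opprD opprK !addrA.
  rewrite (le_lt_trans (ler_normD _ _)) // normrZ ger0_norm ?subr_ge0 //.
  have : (1 - t) * `|u q *: e| <= `|u q *: e|.
    by rewrite ler_piMl // lerBlDr lerDl.
  by move: ueq pq; lra.
have inU t : 0 <= t <= 1 -> U (q - u q *: e + t *: (u q *: e)).
  by move=> /inb bt; apply/d'P/(le_ball _ bt); rewrite ge_min lexx orbT.
have slice : u (q - u q *: e) = 0.
  by rewrite -scaleN1r addrC linu uZ ue mulr1 scaleN1r addNr.
have [t th|t th] := @MVT_line R V h (q - u q *: e) (u q *: e) 1 ltr01.
  exact: (sh [::] _ (inU t th)).
have Uq : U (q - u q *: e).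
  by move: (inU 0); rewrite scale0r addr0 lexx ler01; apply.
rewrite scale1r subrK (h0 _ Uq slice) subr0 mul1r => ->; set y := _ + t *: _.
have Uy : U y by exact: inU.
have dh := smooth_on_differentiable sh Uy.
have -> : 'D_(u q *: e) h y = u q * 'D_e h y by rewrite !deriveE // linearZ.
have Dy : `|'D_e h y| <= C * `|u y ^+ k|.
  by apply: dP; apply: le_ball (inb t th); rewrite ge_min lexx.
have uy : u y = t * u q by rewrite /y addrC linu slice addr0 uZ ue mulr1.
rewrite exprS !normrM mulrCA ler_wpM2l // (le_trans Dy) // ler_pM2l // uy exprMn normrM ler_piMl //.
by have /andP[t0 t1] := th; rewrite normrX ger0_norm // exprn_ile1.
Qed.

End JetsBigO.

Lemma iter_derive_monomial (R : realType) (c : R) (j i : nat) : (i <= j)%N ->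
  iter i (fun f : R -> R => 'D_1 f) (fun t : R => c * t ^+ j) =
  (fun t : R => c * (j ^_ i)%:R * t ^+ (j - i)).
Proof.
elim: i => [|i IH] ij; first by rewrite subn0 ffactn0 mulr1.
rewrite iterS IH ?(ltnW ij) //; apply/funext => t.
rewrite (_ : (fun t0 => _) = (c * (j ^_ i)%:R) *: (fun t0 : R => t0 ^+ (j - i))) //.
rewrite deriveZ; last exact: exprn_derivable.
rewrite exp_derive /GRing.scale /= mulr1 ffactnSr natrM -subnS.
by ring.
Qed.

Section BigOJets.
Context {R : realType} {V : normedModType R} (U : set V).
Hypothesis (oU : open U).
Implicit Types (f g h : V -> R) (x p e : V).

(* If the derivatives of order < j of t |-> h (p + t e) vanish at 0, then
   h (p + t e) = c t^j + O(t^(j+1)), where c is the next Taylor coefficient. *)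
Lemma bigO_iter_derive0 h p e : smooth_on U h -> U p ->
  (forall k, exists2 C, 0 < C &
     \forall t \near (0 : R), `|h (p + t *: e)| <= C * `|t ^+ k|) ->
  forall j, iter j (fun f => 'D_e f) h p = 0.
Proof.
move=> sh Up hO.
pose L (t : R) := p + t *: e.
have dL t : differentiable L t.
  exact: differentiableD (differentiable_cst _ _)
    (differentiableZl e (@ex_diff _ _ _ _ _ idfun _ _)).
have affL (a s t : R) : L (a *: s + t) = a *: (s *: e) + L t.
  by rewrite /L scalerDl -scalerA addrCA.
pose F t := h (L t); pose A := L @^-1` U.
have oA : open A.
  by apply: open_comp => // t _; exact: differentiable_continuous.
have A0 : A 0 by rewrite /A /preimage /L /= scale0r addr0.
have sF : smooth_on A F := smooth_on_comp_affine affL dL sh.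
have DF j t : iter j (fun f : R -> R => 'D_1 f) F t = iter j (fun f => 'D_e f) h (L t).
  elim: j t => // j IH t; rewrite !iterS (funext IH).
  by rewrite (derive_comp_affine affL) scale1r.
move=> j; rewrite -[p]addr0 -(scale0r e) -/(L 0) -DF.
elim/ltn_ind: j => j IH.
set a := iter j _ F 0; pose c := a / j`!%:R.
have jf : j`!%:R != 0 :> R by rewrite pnatr_eq0 -lt0n fact_gt0.
suff c0 : c = 0 by move: c0; rewrite /c => /eqP; rewrite mulf_eq0 invr_eq0 (negbTE jf) orbF => /eqP.
pose m (t : R) := c * t ^+ j.
have lid : linear (idfun : R -> R) by [].
have did (t : R) : differentiable (idfun : R -> R) t by exact: ex_diff.
have sid : smooth_on A (idfun : R -> R).
  exact: smooth_on_linear.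
have sm : smooth_on A m.
  apply: smooth_onM => //; first exact: smooth_on_cst.
  elim: (j) => [|i si]; first by apply: smooth_on_cst.
  by apply: smooth_on_eq (smooth_onM oA sid si) => // x _; rewrite exprS.
(* Below order j both sides have vanishing derivatives at 0, [F] by induction and the monomial by
   its degree; at order j both equal [a], by the factor j! in the definition of [c]. *)
have cFm : cong A idfun (1 : R) j.+1 F m.
  split=> //; apply/jet_eqP => i; rewrite ltnS => ij t _ /= ->.
  rewrite iter_derive_monomial //; case: (ltngtP i j) ij => // [ij|->] _.
    by rewrite IH // expr0n subn_eq0 leqNgt ij mulr0.
  by rewrite subnn mulr1 ffactnn /c divfK.
have [sFm _ jFm] := congB oA cFm (cong_refl _ (1 : R) j.+1 sm).
have jFm0 : jet_eq A idfun (1 : R) j.+1 (fun t => F t - m t) (cst 0).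
  by apply: (jet_eq_on oA _ _ jFm) => // x _; rewrite subrr.
have [C C0 nC] := jet0_bigO oA lid did erefl sFm jFm0 A0 erefl.
have [C' C'0 nC'] := hO j.+1.
apply/eqP; rewrite -normr_le0; apply/ler_addgt0Pr => eps eps0; rewrite add0r.
(* At a positive t the power t^j can be cancelled, which leaves |c| <= (C + C') t < eps. *)
have : \forall t \near (0 : R)^'+,
    [/\ 0 < t, t < eps / (C + C') & `|c| * t ^+ j <= (C + C') * t ^+ j.+1].
  near=> t.
  have t0 : 0 < t by near: t; exact: nbhs_right_gt.
  split=> //; first by near: t; apply: nbhs_right_lt; rewrite divr_gt0 ?addr_gt0.
  have h1 : `|F t - m t| <= C * `|t ^+ j.+1|.
    by near: t; exact: (cvg_within _ nC).
  have h2 : `|F t| <= C' * `|t ^+ j.+1|.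
    by near: t; exact: (cvg_within _ nC').
  have tn i : `|t ^+ i| = t ^+ i by rewrite ger0_norm // exprn_ge0 // ltW.
  rewrite tn in h1; rewrite tn in h2.
  have : `|m t| <= `|F t| + `|F t - m t|.
    have {1}-> : m t = F t - (F t - m t) by ring.
    exact: ler_normB.
  by rewrite {1}/m normrM tn mulrDl; lra.
move=> /filter_ex[t [t0 te]].
rewrite exprS mulrA ler_pM2r ?exprn_gt0 // => /le_trans; apply.
by move: te; rewrite ltr_pdivlMr ?addr_gt0 // mulrC => /ltW.
Unshelve. all: by end_near. Qed.

End BigOJets.

(** * Curvature of the ambient metric *)

Section AmbientBlocks.
Context {R : realType} {n : nat}.
Local Notation N := (1 + (n + 1))%N.

Definition idx_v : 'I_N := lshift (n + 1) ord0.
Definition idx_x (k : 'I_n) : 'I_N := rshift 1 (lshift 1 k).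
Definition idx_u : 'I_N := rshift 1 (rshift n ord0).

Lemma idx_ind (P : 'I_N -> Prop) :
  P idx_v -> (forall k, P (idx_x k)) -> P idx_u -> forall a, P a.
Proof.
move=> Pv Px Pu a; case: (split_ordP a) => [j ->|j ->]; first by rewrite (ord1 j).
by case: (split_ordP j) => [k ->|k ->]; [exact: Px|rewrite (ord1 k)].
Qed.

Lemma sum_idx (F : 'I_N -> R) :
  \sum_a F a = F idx_v + (\sum_k F (idx_x k) + F idx_u).
Proof. by rewrite big_split_ord big_ord1 /= big_split_ord big_ord1. Qed.

Definition ambient_mx (A : 'M[R]_n) : 'M[R]_N :=
  block_mx (0 : 'M[R]_(1, 1)) (row_mx (0 : 'M[R]_(1, n)) 1%:M)
           (col_mx (0 : 'M[R]_(n, 1)) 1%:M)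
           (block_mx A 0 0 0).

Lemma ambient_mxE (A : 'M[R]_n) :
  (ambient_mx A idx_v idx_v = 0) * (ambient_mx A idx_v idx_u = 1) *
  (ambient_mx A idx_u idx_v = 1) * (ambient_mx A idx_u idx_u = 0) *
  (forall i, ambient_mx A idx_v (idx_x i) = 0) *
  (forall i, ambient_mx A (idx_x i) idx_v = 0) *
  (forall i, ambient_mx A (idx_x i) idx_u = 0) *
  (forall i, ambient_mx A idx_u (idx_x i) = 0) *
  (forall i j, ambient_mx A (idx_x i) (idx_x j) = A i j).
Proof.
rewrite /ambient_mx /idx_v /idx_u /idx_x.
by do !split; move=> *; rewrite ?(block_mxEul, block_mxEur, block_mxEdl, block_mxEdr,
  row_mxEl, row_mxEr, col_mxEu, col_mxEd) ?mxE.
Qed.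

Lemma ambient_mx_mul (A B : 'M[R]_n) : A *m B = 1%:M ->
  ambient_mx A *m ambient_mx B = 1%:M.
Proof.
move=> AB; apply/matrixP; apply: idx_ind => [|i|]; apply: idx_ind => [|j|];
  rewrite !mxE sum_idx ?ambient_mxE;
  under eq_bigr do rewrite !ambient_mxE ?(mul0r, mulr0).
all: rewrite ?big1_eq ?(mul0r, mulr0, add0r, addr0, mul1r)
  ?(inj_eq (@rshift_inj _ _), inj_eq (@lshift_inj _ _)) //.
- by have /matrixP/(_ i j) := AB; rewrite !mxE.
- by rewrite eq_lrshift.
- by rewrite eq_rlshift.
Qed.

(* For singular A both sides are [ambient_mx A], because [invmx] is the identity on
   singular matrices; thus the formulas below hold at every point. *)
Lemma invmx_ambient (A : 'M[R]_n) : invmx (ambient_mx A) = ambient_mx (invmx A).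
Proof.
have [Au|Au] := boolP (A \in unitmx).
  have E := ambient_mx_mul (mulmxV Au).
  have [Gu _] := mulmx1_unit E.
  by rewrite -[LHS]mulmx1 -E mulKmx.
rewrite /invmx (negbTE Au); case: ifP => // Gu; case/negP: Au.
(* If the ambient matrix were invertible, the middle block of its inverse would be a right inverse
   of the singular [A]. *)
pose C : 'M[R]_n := \matrix_(i, j) invmx (ambient_mx A) (idx_x i) (idx_x j).
suff /mulmx1_unit[] : A *m C = 1%:M by [].
apply/matrixP => i j; have /matrixP/(_ (idx_x i) (idx_x j)) := mulmxV Gu.
rewrite !mxE sum_idx !ambient_mxE !mul0r add0r addr0.
under eq_bigr do rewrite ambient_mxE; move=> E.
by under eq_bigr do rewrite mxE; rewrite E.
Qed.

(** The null coordinates v and u are paired with each other, so contraction with the inverse metric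
    exchanges these two indices and acts by the inverse of g_u on the others. *)
Lemma sum_ambient_mx (A : 'M[R]_n) (F : 'I_N -> R) :
  (\sum_d ambient_mx A idx_v d * F d = F idx_u) *
  (\sum_d ambient_mx A idx_u d * F d = F idx_v) *
  (forall k, \sum_d ambient_mx A (idx_x k) d * F d = \sum_l A k l * F (idx_x l)).
Proof.
do !split; [| |move=> k]; rewrite sum_idx !ambient_mxE !(mul0r, mul1r);
  under eq_bigr do rewrite ambient_mxE ?mul0r.
- by rewrite big1_eq !add0r.
- by rewrite big1_eq !addr0.
- by rewrite add0r addr0.
Qed.

(* Ambient fields do not depend on v, apart from the term -v of the density, so they
   factor through this projection, and derivatives along v become derivatives in
   direction 0. *)
Definition slice_coord (y : 'rV[R]_N) : R * 'rV[R]_n := (coord_u y, coord_x y).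

Lemma slice_coord_linear : linear slice_coord.
Proof.
move=> a y z; rewrite /slice_coord /coord_u /coord_x.
by apply/pair_equal_spec; rewrite !linearP !mxE; split.
Qed.

Definition dir_x (k : 'I_n) : R * 'rV[R]_n := (0, delta_mx 0 k).
Definition dir_u : R * 'rV[R]_n := (1, 0).

Lemma slice_coord_delta :
  (slice_coord (delta_mx 0 idx_v) = 0) *
  (forall k, slice_coord (delta_mx 0 (idx_x k)) = dir_x k) *
  (slice_coord (delta_mx 0 idx_u) = dir_u).
Proof.
rewrite /slice_coord /coord_u /coord_x /dir_x /dir_u /idx_v /idx_x /idx_u.
do !split; [|move=> k|]; congr (_, _); try apply/rowP => j; rewrite !mxE //=.
all: rewrite ?(eq_lrshift, eq_rlshift, eq_rshift, eq_lshift) ?eqxx ?andbF //.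
Qed.

Lemma coord_v_delta :
  (coord_v (delta_mx 0 idx_v : 'rV[R]_N) = 1) *
  (forall k, coord_v (delta_mx 0 (idx_x k) : 'rV[R]_N) = 0) *
  (coord_v (delta_mx 0 idx_u : 'rV[R]_N) = 0).
Proof.
rewrite /coord_v /idx_v /idx_x /idx_u.
by do !split; move=> *; rewrite !mxE //= ?eqxx.
Qed.

End AmbientBlocks.

Section AmbientFormulas.
Context {R : realType} {n : nat}.
Local Notation N := (1 + (n + 1))%N.
Local Notation Q := (R * 'rV[R]_n)%type.
Local Notation idx_v := (@idx_v n).
Local Notation idx_u := (@idx_u n).
Local Notation idx_x := (@idx_x n).
Local Notation dir_u := (@dir_u R n).
Local Notation dir_x := (@dir_x R n).
Local Notation L := (@slice_coord R n).
Implicit Types (q : Q) (y : 'rV[R]_N) (a b c : 'I_N) (i j k l : 'I_n).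

Lemma partial_slice_coord (f : Q -> R) a :
  partial a (fun y => f (L y)) = fun y => 'D_(L (delta_mx 0 a)) f (L y).
Proof.
apply/funext => y; rewrite /partial.
exact: (@derive_comp_affine _ _ _ L L (@slice_coord_linear R n)).
Qed.

Section RicciBlocks.
Variables (gam : 'I_N -> 'I_N -> 'I_N -> Q -> R) (gx : 'I_n -> 'I_n -> 'I_n -> Q -> R).
Variables (sh s2 : 'I_n -> 'I_n -> Q -> R).
Hypothesis gamE :
  (forall a b, gam idx_u a b = cst 0) *
  (forall c b, gam c idx_v b = cst 0) *
  (forall c a, gam c a idx_v = cst 0) *
  (forall b, gam idx_v idx_u b = cst 0) *
  (forall a, gam idx_v a idx_u = cst 0) *
  (forall c, gam c idx_u idx_u = cst 0) *
  (forall i j, gam idx_v (idx_x i) (idx_x j) = s2 i j) *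
  (forall k i, gam (idx_x k) (idx_x i) idx_u = sh k i) *
  (forall k i, gam (idx_x k) idx_u (idx_x i) = sh k i) *
  (forall k i j, gam (idx_x k) (idx_x i) (idx_x j) = gx k i j).

Let ric a b q := \sum_c ('D_(L (delta_mx 0 c)) (gam c a b) q
  - 'D_(L (delta_mx 0 a)) (gam c c b) q
  + \sum_d (gam c c d q * gam d a b q - gam c a d q * gam d c b q)).

(** Only the vanishing pattern of the symbols matters, so they are kept abstract. Symbols with upper
    u or with a lower v are zero and nothing is differentiated along v, hence the summation indices
    c and d range effectively over the directions of M. *)
Lemma ricci_blocks q :
  (forall b, ric idx_v b q = 0) * (forall a, ric a idx_v q = 0) *
  (forall i j, ric (idx_x i) (idx_x j) q = \sum_(k < n)
     ('D_(dir_x k) (gx k i j) q - 'D_(dir_x i) (gx k k j) q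
      + \sum_(p < n) (gx k k p q * gx p i j q - gx k i p q * gx p k j q))) *
  (forall i, ric (idx_x i) idx_u q = \sum_(k < n)
     ('D_(dir_x k) (sh k i) q - 'D_(dir_x i) (sh k k) q
      + \sum_(p < n) (gx k k p q * sh p i q - gx k i p q * sh p k q))) *
  (forall i, ric idx_u (idx_x i) q = \sum_(k < n)
     ('D_(dir_x k) (sh k i) q - 'D_dir_u (gx k k i) q
      + \sum_(p < n) (gx k k p q * sh p i q - sh k p q * gx p k i q))) *
  (ric idx_u idx_u q = \sum_(k < n)
     (- 'D_dir_u (sh k k) q - \sum_(p < n) sh k p q * sh p k q)).
Proof.
have ricE a b : ric a b q = \sum_(k < n)
    ('D_(dir_x k) (gam (idx_x k) a b) q
     - 'D_(L (delta_mx 0 a)) (gam (idx_x k) (idx_x k) b) q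
     + \sum_(p < n) (gam (idx_x k) (idx_x k) (idx_x p) q * gam (idx_x p) a b q
                    - gam (idx_x k) a (idx_x p) q * gam (idx_x p) (idx_x k) b q)).
  rewrite /ric sum_idx slice_coord_delta !gamE !derive_cst derive0 subrr add0r.
  rewrite big1; last by move=> d _; rewrite !gamE mul0r mulr0 subrr.
  rewrite !add0r [X in _ + X]big1 ?addr0; last by move=> d _; rewrite !gamE !mul0r subrr.
  apply: eq_bigr => k _; rewrite slice_coord_delta; congr (_ + _).
  by rewrite sum_idx !gamE /= !(mul0r, mulr0, oppr0, add0r, addr0).
do !split.
- move=> b; rewrite ricE big1 // => k _; rewrite slice_coord_delta !gamE derive_cst derive0.
  by rewrite big1 ?addr0 ?subr0 // => d _; rewrite !gamE mul0r mulr0 subrr.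
- move=> a; rewrite ricE big1 // => k _; rewrite !gamE !derive_cst subr0 add0r big1 // => d _.
  by rewrite !gamE !mulr0 subrr.
- move=> i j; rewrite ricE; apply: eq_bigr => k _; rewrite slice_coord_delta !gamE.
  by congr (_ + _); apply: eq_bigr => p _; rewrite !gamE.
- move=> i; rewrite ricE; apply: eq_bigr => k _; rewrite slice_coord_delta !gamE.
  by congr (_ + _); apply: eq_bigr => p _; rewrite !gamE.
- move=> i; rewrite ricE; apply: eq_bigr => k _; rewrite slice_coord_delta !gamE.
  by congr (_ + _); apply: eq_bigr => p _; rewrite !gamE.
- rewrite ricE; apply: eq_bigr => k _; rewrite slice_coord_delta !gamE derive_cst sub0r.
  by rewrite -sumrN; congr (_ + _); apply: eq_bigr => p _; rewrite !gamE mulr0 sub0r.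
Qed.
End RicciBlocks.

Variable B : Q -> 'M[R]_n.

(** The Levi-Civita symbols of g_u for frozen u, regarded as functions of (u, x) so that they can
    also be differentiated in u. *)
Definition slice_christoffel k i j q : R :=
  2^-1 * \sum_(l < n) invmx (B q) k l *
    ('D_(dir_x i) (fun p => B p j l) q + 'D_(dir_x j) (fun p => B p i l) q
     - 'D_(dir_x l) (fun p => B p i j) q).

(* The mixed ambient Christoffel symbols Gamma^k_{iu}. *)
Definition slice_shape k i q : R :=
  2^-1 * \sum_(l < n) invmx (B q) k l * 'D_dir_u (fun p => B p i l) q.

Definition slice_ricci i j q : R :=
  \sum_(k < n) ('D_(dir_x k) (slice_christoffel k i j) q
    - 'D_(dir_x i) (slice_christoffel k k j) q
    + \sum_(p < n) (slice_christoffel k k p q * slice_christoffel p i j q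
                    - slice_christoffel k i p q * slice_christoffel p k j q)).

Local Notation G := (fun y => ambient_mx (B (L y))).

Definition ambient_dmx a b c q : R := 'D_(L (delta_mx 0 a)) (fun p => ambient_mx (B p) b c) q.

Lemma partial_ambient_mx a b c y : partial a (fun z => G z b c) y = ambient_dmx a b c (L y).
Proof. by rewrite (partial_slice_coord (fun p => ambient_mx (B p) b c)). Qed.

Lemma ambient_dmx_cst a b c (r : R) : (forall A : 'M[R]_n, ambient_mx A b c = r) ->
  forall q, ambient_dmx a b c q = 0.
Proof.
move=> E q; rewrite /ambient_dmx (_ : (fun p => _) = cst r) ?derive_cst //.
exact/funext.
Qed.

Lemma ambient_dmxE :
  (forall b c q, ambient_dmx idx_v b c q = 0) * (forall a c q, ambient_dmx a idx_v c q = 0) *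
  (forall a b q, ambient_dmx a b idx_v q = 0) * (forall a c q, ambient_dmx a idx_u c q = 0) *
  (forall a b q, ambient_dmx a b idx_u q = 0) *
  (forall i j q, ambient_dmx idx_u (idx_x i) (idx_x j) q = 'D_dir_u (fun p => B p i j) q) *
  (forall k i j q, ambient_dmx (idx_x k) (idx_x i) (idx_x j) q = 'D_(dir_x k) (fun p => B p i j) q).
Proof.
have bxx i j : (fun p => ambient_mx (B p) (idx_x i) (idx_x j)) = (fun p => B p i j).
  by apply/funext => p; rewrite ambient_mxE.
do !split.
- by move=> b c q; rewrite /ambient_dmx slice_coord_delta derive0.
- move=> a; apply: idx_ind => [|k|] q; apply: ambient_dmx_cst => A; by rewrite ambient_mxE.
- move=> a; apply: idx_ind => [|k|] q; apply: ambient_dmx_cst => A; by rewrite ambient_mxE.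
- move=> a; apply: idx_ind => [|k|] q; apply: ambient_dmx_cst => A; by rewrite ambient_mxE.
- move=> a; apply: idx_ind => [|k|] q; apply: ambient_dmx_cst => A; by rewrite ambient_mxE.
- by move=> i j q; rewrite /ambient_dmx slice_coord_delta bxx.
- by move=> k i j q; rewrite /ambient_dmx slice_coord_delta bxx.
Qed.

Definition ambient_christoffel c a b q : R := 2^-1 * \sum_d ambient_mx (invmx (B q)) c d *
  (ambient_dmx a b d q + ambient_dmx b a d q - ambient_dmx d a b q).

(** An equality of functions on the whole space, since the curvature differentiates the symbols once
    more. *)
Lemma christoffel_ambient : christoffel G = fun c a b y => ambient_christoffel c a b (L y).
Proof.
have E c a b y : christoffel G c a b y = ambient_christoffel c a b (L y).
  rewrite /christoffel /ambient_christoffel invmx_ambient.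
  apply: congr1; apply: eq_bigr => d _.
  by rewrite !partial_ambient_mx.
by do 3!apply/funext => ?; apply/funext => y; exact: E.
Qed.

(** The only symbols with upper index v are Gamma^v_ij = -1/2 d_u (g_u)_ij. In the Hessian they meet
    the v-derivative -1 of the density, which is where the term -1/2 d_u g_u of P comes from. *)
Lemma ambient_christoffelE :
  (forall a b, ambient_christoffel idx_u a b = cst 0) *
  (forall c b, ambient_christoffel c idx_v b = cst 0) *
  (forall c a, ambient_christoffel c a idx_v = cst 0) *
  (forall b, ambient_christoffel idx_v idx_u b = cst 0) *
  (forall a, ambient_christoffel idx_v a idx_u = cst 0) *
  (forall c, ambient_christoffel c idx_u idx_u = cst 0) *
  (forall i j, ambient_christoffel idx_v (idx_x i) (idx_x j) =
     fun q => - (2^-1 * 'D_dir_u (fun p => B p i j) q)) *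
  (forall k i, ambient_christoffel (idx_x k) (idx_x i) idx_u = slice_shape k i) *
  (forall k i, ambient_christoffel (idx_x k) idx_u (idx_x i) = slice_shape k i) *
  (forall k i j, ambient_christoffel (idx_x k) (idx_x i) (idx_x j) = slice_christoffel k i j).
Proof.
have cu a b q : ambient_christoffel idx_u a b q = 0.
  by rewrite /ambient_christoffel sum_ambient_mx !ambient_dmxE !(addr0, subr0) mulr0.
have cv a b q : ambient_christoffel idx_v a b q = - (2^-1 * ambient_dmx idx_u a b q).
  by rewrite /ambient_christoffel sum_ambient_mx !ambient_dmxE !add0r mulrN.
have cx k a b q : ambient_christoffel (idx_x k) a b q = 2^-1 * \sum_(l < n) invmx (B q) k l *
    (ambient_dmx a b (idx_x l) q + ambient_dmx b a (idx_x l) q - ambient_dmx (idx_x l) a b q).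
  by rewrite /ambient_christoffel sum_ambient_mx.
do !split.
- by move=> a b; apply/funext => q; rewrite cu.
- apply: idx_ind => [|k|] b; apply/funext => q;
    rewrite ?(cu, cv, cx) ?ambient_dmxE ?mulr0 ?oppr0 //.
  by rewrite big1 ?mulr0 // => l _; rewrite !ambient_dmxE subr0 addr0 mulr0.
- apply: idx_ind => [|k|] b; apply/funext => q;
    rewrite ?(cu, cv, cx) ?ambient_dmxE ?mulr0 ?oppr0 //.
  by rewrite big1 ?mulr0 // => l _; rewrite !ambient_dmxE subr0 addr0 mulr0.
- by move=> b; apply/funext => q; rewrite cv !ambient_dmxE mulr0 oppr0.
- by move=> b; apply/funext => q; rewrite cv !ambient_dmxE mulr0 oppr0.
- apply: idx_ind => [|k|]; apply/funext => q;
    rewrite ?(cu, cv, cx) ?ambient_dmxE ?mulr0 ?oppr0 //.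
  by rewrite big1 ?mulr0 // => l _; rewrite !ambient_dmxE subr0 addr0 mulr0.
- by move=> i j; apply/funext => q; rewrite cv ambient_dmxE.
- move=> k i; apply/funext => q; rewrite cx /slice_shape.
  by under eq_bigr do rewrite !ambient_dmxE subr0 add0r.
- move=> k i; apply/funext => q; rewrite cx /slice_shape.
  by under eq_bigr do rewrite !ambient_dmxE subr0 addr0.
- move=> k i j; apply/funext => q; rewrite cx /slice_christoffel.
  by under eq_bigr do rewrite !ambient_dmxE.
Qed.

Lemma ricci_ambient_sum y a b : ricci G y a b = \sum_c
  ('D_(L (delta_mx 0 c)) (ambient_christoffel c a b) (L y)
   - 'D_(L (delta_mx 0 a)) (ambient_christoffel c c b) (L y)
   + \sum_d (ambient_christoffel c c d (L y) * ambient_christoffel d a b (L y)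
             - ambient_christoffel c a d (L y) * ambient_christoffel d c b (L y))).
Proof.
rewrite mxE; apply: eq_bigr => c _; rewrite /riemann christoffel_ambient.
by rewrite (partial_slice_coord (ambient_christoffel c a b))
  (partial_slice_coord (ambient_christoffel c c b)).
Qed.

Lemma ricci_ambient y :
  (forall b, ricci G y idx_v b = 0) * (forall a, ricci G y a idx_v = 0) *
  (forall i j, ricci G y (idx_x i) (idx_x j) = slice_ricci i j (L y)) *
  (forall i, ricci G y (idx_x i) idx_u = \sum_(k < n)
     ('D_(dir_x k) (slice_shape k i) (L y) - 'D_(dir_x i) (slice_shape k k) (L y)
      + \sum_(p < n) (slice_christoffel k k p (L y) * slice_shape p i (L y)
                      - slice_christoffel k i p (L y) * slice_shape p k (L y)))) *
  (forall i, ricci G y idx_u (idx_x i) = \sum_(k < n)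
     ('D_(dir_x k) (slice_shape k i) (L y) - 'D_dir_u (slice_christoffel k k i) (L y)
      + \sum_(p < n) (slice_christoffel k k p (L y) * slice_shape p i (L y)
                      - slice_shape k p (L y) * slice_christoffel p k i (L y)))) *
  (ricci G y idx_u idx_u = \sum_(k < n)
     (- 'D_dir_u (slice_shape k k) (L y)
      - \sum_(p < n) slice_shape k p (L y) * slice_shape p k (L y))).
Proof.
have := ricci_blocks ambient_christoffelE (L y).
move=> [[[[[Rv Rw] Rxx] Rxu] Rux] Ruu].
split; first split; first split; first split; first split.
- by move=> b; rewrite ricci_ambient_sum; exact: Rv.
- by move=> a; rewrite ricci_ambient_sum; exact: Rw.
- by move=> i j; rewrite ricci_ambient_sum; exact: Rxx.
- by move=> i; rewrite ricci_ambient_sum; exact: Rxu.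
- by move=> i; rewrite ricci_ambient_sum; exact: Rux.
- by rewrite ricci_ambient_sum; exact: Ruu.
Qed.
Variable psi : Q -> R.

Definition slice_hessian i j q : R :=
  'D_(dir_x i) ('D_(dir_x j) psi) q
  - \sum_(k < n) slice_christoffel k i j q * 'D_(dir_x k) psi q.

Local Notation dens := (fun y => psi (L y) - coord_v y).

Lemma partial_density :
  (partial idx_v dens = cst (-1)) *
  (forall k, partial (idx_x k) dens = fun y => 'D_(dir_x k) psi (L y)) *
  (partial idx_u dens = fun y => 'D_dir_u psi (L y)).
Proof.
have cvD (h : R) (w y : 'rV[R]_N) : coord_v (h *: w + y) = h * coord_v w + coord_v y.
  by rewrite /coord_v !mxE.
have tang a : coord_v (delta_mx 0 a : 'rV[R]_N) = 0 ->
    partial a dens = fun y => 'D_(L (delta_mx 0 a)) psi (L y).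
  move=> a0; rewrite -(partial_slice_coord psi); apply/funext => y.
  rewrite /partial /derive; set p := fun h => _; set p' := fun h => _.
  suff -> : p = p' by [].
  apply/funext => h; rewrite /p /p' /= cvD a0 mulr0 add0r; congr (_ *: _).
  by ring.
do !split.
- apply/funext => y; rewrite -[RHS]/(-1) /partial /derive; apply: cvg_lim => //.
  apply: cvg_near_cst; near=> h => /=.
  rewrite cvD coord_v_delta slice_coord_linear slice_coord_delta scaler0 add0r mulr1.
  rewrite /GRing.scale /= (_ : psi _ - _ - _ = - h); last by ring.
  by rewrite mulrN mulVf //; near: h; exact: nbhs_dnbhs_neq.
- by move=> k; rewrite (tang _ (coord_v_delta.1.2 k)) slice_coord_delta.
- by rewrite (tang _ coord_v_delta.2) slice_coord_delta.
Unshelve. all: by end_near. Qed.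

Lemma hessian_ambient_sum y a b : hessian G dens y a b = partial a (partial b dens) y
  - (ambient_christoffel idx_v a b (L y) * -1
     + (\sum_(k < n) ambient_christoffel (idx_x k) a b (L y) * 'D_(dir_x k) psi (L y)
        + ambient_christoffel idx_u a b (L y) * 'D_dir_u psi (L y))).
Proof.
rewrite mxE christoffel_ambient sum_idx; congr (_ - (_ + (_ + _))).
- by rewrite partial_density.
- by apply: eq_bigr => k _; rewrite partial_density.
- by rewrite partial_density.
Qed.

Lemma hessian_ambient y :
  (forall b, hessian G dens y idx_v b = 0) * (forall a, hessian G dens y a idx_v = 0) *
  (forall i j, hessian G dens y (idx_x i) (idx_x j) =
     slice_hessian i j (L y) - 2^-1 * 'D_dir_u (fun q => B q i j) (L y)) *
  (forall i, hessian G dens y (idx_x i) idx_u = 'D_(dir_x i) ('D_dir_u psi) (L y)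
     - \sum_(k < n) slice_shape k i (L y) * 'D_(dir_x k) psi (L y)) *
  (forall i, hessian G dens y idx_u (idx_x i) = 'D_dir_u ('D_(dir_x i) psi) (L y)
     - \sum_(k < n) slice_shape k i (L y) * 'D_(dir_x k) psi (L y)) *
  (hessian G dens y idx_u idx_u = 'D_dir_u ('D_dir_u psi) (L y)).
Proof.
have cstE (r : R) : (cst r (L y) : R) = r by [].
have D0 a (r : R) : partial a (cst r : 'rV[R]_N -> R) y = 0 by exact: derive_cst.
have Dv (f : Q -> R) : partial idx_v (fun z => f (L z)) y = 0.
  by rewrite partial_slice_coord slice_coord_delta derive0.
have s0 (F : 'I_n -> R) : \sum_(k < n) 0 * F k = 0.
  by rewrite big1 // => k _; rewrite mul0r.
split; first split; first split; first split; first split.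
- move=> b; rewrite hessian_ambient_sum !ambient_christoffelE !cstE !mul0r add0r addr0 big1.
    rewrite subr0; move: b; apply: idx_ind => [|k|]; rewrite partial_density.
    + exact: D0.
    + exact: (Dv ('D_(dir_x k) psi)).
    + exact: (Dv ('D_dir_u psi)).
  by move=> k _; rewrite ambient_christoffelE cstE mul0r.
- move=> a; rewrite hessian_ambient_sum !ambient_christoffelE partial_density D0.
  rewrite !cstE !mul0r big1 ?addr0 ?oppr0 ?addr0 //.
  by move=> k _; rewrite ambient_christoffelE cstE mul0r.
- move=> i j; rewrite hessian_ambient_sum !ambient_christoffelE partial_density cstE mul0r addr0.
  rewrite (partial_slice_coord ('D_(dir_x j) psi)) slice_coord_delta /slice_hessian.
  under eq_bigr do rewrite ambient_christoffelE.
  by rewrite mulrN1 opprK opprD addrA [_ + _ - _]addrAC.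
- move=> i; rewrite hessian_ambient_sum !ambient_christoffelE partial_density.
  rewrite !cstE !mul0r addr0 add0r.
  rewrite (partial_slice_coord ('D_dir_u psi)) slice_coord_delta.
  by under eq_bigr do rewrite ambient_christoffelE.
- move=> i; rewrite hessian_ambient_sum !ambient_christoffelE partial_density.
  rewrite !cstE !mul0r addr0 add0r.
  rewrite (partial_slice_coord ('D_(dir_x i) psi)) slice_coord_delta.
  by under eq_bigr do rewrite ambient_christoffelE.
- rewrite hessian_ambient_sum !ambient_christoffelE partial_density !cstE !mul0r addr0 add0r.
  rewrite (partial_slice_coord ('D_dir_u psi)) slice_coord_delta.
  rewrite big1 ?subr0 // => k _; by rewrite ambient_christoffelE cstE mul0r.
Qed.

Definition slice_P i j q : R :=
  slice_ricci i j q + slice_hessian i j q - 2^-1 * 'D_dir_u (fun p => B p i j) q.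

Definition slice_F q : R :=
  \sum_(i < n) \sum_(j < n) invmx (B q) i j *
    (slice_hessian i j q - 2^-1 * 'D_dir_u (fun p => B p i j) q)
  - \sum_(i < n) \sum_(j < n) invmx (B q) i j *
    ('D_(dir_x i) psi q * 'D_(dir_x j) psi q)
  + 2 * 'D_dir_u psi q.

Lemma weightedP_ambient y i j :
  weightedP G dens 0 y (idx_x i) (idx_x j) = slice_P i j (L y).
Proof.
have -> : weightedP G dens 0 y (idx_x i) (idx_x j) =
    ricci G y (idx_x i) (idx_x j) + hessian G dens y (idx_x i) (idx_x j).
  by rewrite /weightedP scale0r subr0 mxE.
by rewrite ricci_ambient hessian_ambient /slice_P addrA.
Qed.

(** The pair (u, v) contributes nothing to the Laplacian, because the Hessian vanishes on the v
    direction. To the squared gradient it contributes twice the product of the derivatives -1 and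
    d_u phi_u, whence + 2 d_u phi_u in F. *)
Lemma weightedF_ambient y : weightedF G dens 0 y = slice_F (L y).
Proof.
have double (F : 'I_N -> 'I_N -> R) :
    \sum_a \sum_b invmx (G y) a b * F a b = F idx_v idx_u + F idx_u idx_v
      + \sum_(i < n) \sum_(j < n) invmx (B (L y)) i j * F (idx_x i) (idx_x j).
  rewrite invmx_ambient sum_idx !sum_ambient_mx.
  under eq_bigr do rewrite sum_ambient_mx.
  by rewrite -addrA; congr (_ + _); exact: addrC.
rewrite /weightedF /laplacian /gradsq !double mulr0 mul0r mulr0 subr0 addr0.
rewrite !partial_density !hessian_ambient !add0r /slice_F.
under eq_bigr do under eq_bigr do rewrite hessian_ambient.
under [X in _ - (_ + X)]eq_bigr do under eq_bigr do rewrite !partial_density.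
set a := \sum_(i < n) _; set b := \sum_(i < n) _; set d := 'D_dir_u psi _.
rewrite /cst; ring.
Qed.

End AmbientFormulas.

(** * Formal uniqueness *)

Section SliceCongruence.
Context {R : realType} {n : nat}.
Local Notation Q := (R * 'rV[R]_n)%type.
Local Notation dir_u := (@dir_u R n).
Local Notation dir_x := (@dir_x R n).

Lemma fst_linear : linear (fst : Q -> R).
Proof. by []. Qed.

Lemma snd_linear : linear (snd : Q -> 'rV[R]_n).
Proof. by []. Qed.

Lemma fst_differentiable (q : Q) : differentiable (fst : Q -> R) q.
Proof.
pose f : {linear Q -> R} := fst.
by apply: (@linear_differentiable _ _ _ f) => p; exact: cvg_fst.
Qed.

Lemma snd_differentiable (q : Q) : differentiable (snd : Q -> 'rV[R]_n) q.
Proof.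
pose f : {linear Q -> 'rV[R]_n} := snd.
by apply: (@linear_differentiable _ _ _ f) => p; exact: cvg_snd.
Qed.

Variables (U : set Q) (oU : open U).
Local Notation cong := (cong U (fst : Q -> R) dir_u).
Variables (k : nat) (B B' : Q -> 'M[R]_n) (psi psi' : Q -> R).
Hypotheses (uB : forall q, U q -> B q \in unitmx) (uB' : forall q, U q -> B' q \in unitmx).
Hypothesis cB : forall i j, cong k (fun q => B q i j) (fun q => B' q i j).
Hypothesis cpsi : cong k psi psi'.

Lemma cong_dir_x l (f f' : Q -> R) :
  cong k f f' -> cong k ('D_(dir_x l) f) ('D_(dir_x l) f').
Proof. by apply: cong_derive => //; exact: fst_linear. Qed.

Lemma cong_slice_christoffel l i j :
  cong k (slice_christoffel B l i j) (slice_christoffel B' l i j).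
Proof.
apply: congM => //; first exact: cong_cst.
apply: cong_sum => // p; apply: congM => //; first exact: cong_invmx.
by apply: congB => //; [apply: congD => //|]; exact: cong_dir_x.
Qed.

Lemma cong_slice_ricci i j : cong k (slice_ricci B i j) (slice_ricci B' i j).
Proof.
apply: cong_sum => // l; apply: congD => //.
  by apply: congB => //; apply: cong_dir_x; exact: cong_slice_christoffel.
apply: cong_sum => // p.
by apply: congB => //; apply: congM => //; exact: cong_slice_christoffel.
Qed.

Lemma cong_slice_hessian i j :
  cong k (slice_hessian B psi i j) (slice_hessian B' psi' i j).
Proof.
apply: congB => //; first by do 2!apply: cong_dir_x.
apply: cong_sum => // p; apply: congM => //; first exact: cong_slice_christoffel.
exact: cong_dir_x.
Qed.

(** Removing 2 d_u psi leaves the part of F without normal derivatives of the density. It still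
    contains d_u of the metric, so the congruence of that derivative enters as an assumption. *)
Lemma cong_slice_trace :
  (forall i j, cong k ('D_dir_u (fun q => B q i j)) ('D_dir_u (fun q => B' q i j))) ->
  cong k (fun q => slice_F B psi q - 2 * 'D_dir_u psi q)
         (fun q => slice_F B' psi' q - 2 * 'D_dir_u psi' q).
Proof.
move=> cDB.
have ctr (H H' : 'I_n -> 'I_n -> Q -> R) : (forall i j, cong k (H i j) (H' i j)) ->
    cong k (fun q => \sum_i \sum_j invmx (B q) i j * H i j q)
           (fun q => \sum_i \sum_j invmx (B' q) i j * H' i j q).
  move=> cHH; do 2!apply: cong_sum => // ?.
  by apply: congM => //; exact: cong_invmx.
have c1 := ctr _ _ (fun i j => congB oU (cong_slice_hessian i j)
  (congM oU (cong_cst _ _ oU k 2^-1) (cDB i j))).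
have c2 := ctr _ _ (fun i j => congM oU (cong_dir_x i cpsi) (cong_dir_x j cpsi)).
by apply: cong_on (congB oU c1 c2) => // q _; rewrite /slice_F addrK.
Qed.

End SliceCongruence.

Section FormalUniqueness.
Context {R : realType} {n : nat}.
Local Notation Q := (R * 'rV[R]_n)%type.
Local Notation dir_u := (@dir_u R n).
Local Notation dir_x := (@dir_x R n).
Variables (U : set Q) (oU : open U).
Local Notation cong := (cong U (fst : Q -> R) dir_u).
Local Notation jet_eq := (jet_eq U (fst : Q -> R) dir_u).
Variables (B B' : Q -> 'M[R]_n) (psi psi' : Q -> R).
Hypotheses (uB : forall q, U q -> B q \in unitmx) (uB' : forall q, U q -> B' q \in unitmx).
Hypotheses (sB : forall i j, smooth_on U (fun q => B q i j))
  (sB' : forall i j, smooth_on U (fun q => B' q i j)).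
Hypotheses (spsi : smooth_on U psi) (spsi' : smooth_on U psi').
Hypothesis B0 : forall q, U q -> q.1 = 0 -> B q = B' q.
Hypothesis psi0 : forall q, U q -> q.1 = 0 -> psi q = psi' q.
Hypothesis P0 : forall k i j, jet_eq k (slice_P B psi i j) (slice_P B' psi' i j).
Hypothesis F0 : forall k, jet_eq k (slice_F B psi) (slice_F B' psi').

(** The congruence of order 0 of a function with itself is exactly its smoothness, so the congruence
    lemmas double as smoothness proofs. *)
Lemma slice_P_smooth (A : Q -> 'M[R]_n) (f : Q -> R) i j :
  (forall q, U q -> A q \in unitmx) -> (forall i j, smooth_on U (fun q => A q i j)) ->
  smooth_on U f -> smooth_on U (slice_P A f i j).
Proof.
move=> uA sA sf.
have cA a b : cong 0 (fun q => A q a b) (fun q => A q a b) by exact: cong_refl.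
have cf : cong 0 f f by exact: cong_refl.
have [sP _ _] := congB oU (congD oU (cong_slice_ricci oU uA uA cA i j)
  (cong_slice_hessian oU uA uA cA cf i j))
  (congM oU (cong_cst _ _ oU 0 2^-1) (cong_refl _ _ 0 (smooth_on_derive dir_u (sA i j)))).
exact: sP.
Qed.

Lemma slice_F_smooth (A : Q -> 'M[R]_n) (f : Q -> R) :
  (forall q, U q -> A q \in unitmx) -> (forall i j, smooth_on U (fun q => A q i j)) ->
  smooth_on U f -> smooth_on U (slice_F A f).
Proof.
move=> uA sA sf.
have cA a b : cong 0 (fun q => A q a b) (fun q => A q a b) by exact: cong_refl.
have cf : cong 0 f f by exact: cong_refl.
have cD a b : cong 0 ('D_dir_u (fun q => A q a b)) ('D_dir_u (fun q => A q a b)).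
  exact/cong_refl/smooth_on_derive.
have [sF _ _] := congD oU (cong_slice_trace oU uA uA cA cf cD)
  (congM oU (cong_cst _ _ oU 0 2) (cong_refl _ _ 0 (smooth_on_derive dir_u sf))).
by apply: smooth_on_eq sF => // q _; rewrite /cst subrK.
Qed.

(** The order of the two equations is forced. P contains no normal derivative of the density, so it
    gives d_u of the metric to order k from the congruences at hand; only with this is the trace
    part of F known to order k, and F then gives d_u of the density. *)
Lemma cong_solution k : (forall i j, cong k (fun q => B q i j) (fun q => B' q i j)) /\
  cong k psi psi'.
Proof.
elim: k => [|k [cB cpsi]]; first by split=> [i j|]; split.
have cP i j : cong k (slice_P B psi i j) (slice_P B' psi' i j).
  by split; [exact: slice_P_smooth|exact: slice_P_smooth|exact: P0].
have cF : cong k (slice_F B psi) (slice_F B' psi').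
  by split; [exact: slice_F_smooth|exact: slice_F_smooth|exact: F0].
have cH := cong_slice_hessian oU uB uB' cB cpsi.
have cDB i j : cong k ('D_dir_u (fun q => B q i j)) ('D_dir_u (fun q => B' q i j)).
  have := congM oU (cong_cst _ _ oU k 2)
    (congB oU (congD oU (cong_slice_ricci oU uB uB' cB i j) (cH i j)) (cP i j)).
  by apply: cong_on => // q _; rewrite /slice_P /=; field.
have cDpsi : cong k ('D_dir_u psi) ('D_dir_u psi').
  have := congM oU (cong_cst _ _ oU k 2^-1)
    (congB oU cF (cong_slice_trace oU uB uB' cB cpsi cDB)).
  by apply: cong_on => // q _; rewrite /cst /=; field.
split=> [i j|]; apply: congS => //.
  by move=> q Uq q0; rewrite B0.
Qed.

End FormalUniqueness.

(** * Estimates in ambient coordinates, on u-lines and on the manifold *)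

Section OinftyTransfer.
Context {R : realType}.

Lemma OinftyP (T : topologicalType) (u : T -> R) (A : set T) (f : T -> R) :
  Oinfty u A f <-> forall p, A p -> u p = 0 -> forall k : nat,
    exists2 C, 0 < C & \forall q \near p, `|f q| <= C * `|u q ^+ k|.
Proof.
by split=> fO p Ap up k; apply/eqO_exP; exact: fO.
Qed.

Lemma Oinfty_near0 (T : topologicalType) (u : T -> R) (A : set T) (f : T -> R) :
  (forall p, A p -> u p = 0 -> \forall q \near p, f q = 0) -> Oinfty u A f.
Proof.
move=> f0; apply/OinftyP => p Ap up k; exists 1 => //.
by apply: filterS (f0 p Ap up) => q ->; rewrite normr0 mul1r.
Qed.

Lemma Oinfty_path (T : topologicalType) (u : T -> R) (A : set T) (f : T -> R)
    (gam : R -> T) : Oinfty u A f -> {for 0, continuous gam} -> A (gam 0) ->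
  (forall t, u (gam t) = t) -> forall k : nat,
  exists2 C, 0 < C & \forall t \near (0 : R), `|f (gam t)| <= C * `|t ^+ k|.
Proof.
move=> /OinftyP fO cg A0 ug k.
have [C C0 nC] := fO _ A0 (ug 0) k; exists C => //.
apply: (@filterS _ (nbhs (0 : R)) _ _ _ _ (cg _ nC)) => t /=; by rewrite ug.
Qed.

Variable n : nat.
Local Notation Q := (R * 'rV[R]_n)%type.
Local Notation N := (1 + (n + 1))%N.
Local Notation dir_u := (@dir_u R n).

(** The hypotheses are estimates in all of (v, x, u), but normal derivatives on the slice are seen
    on u-lines alone, where |u| is the distance parameter. *)
Lemma Oinfty_slice_line (D : set 'rV[R]_n) (h : Q -> R) (q : Q) :
  Oinfty (@coord_u R n) [set y | D (coord_x y)] (fun y => h (slice_coord y)) ->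
  q.1 = 0 -> D q.2 -> forall k : nat,
  exists2 C, 0 < C & \forall t \near (0 : R), `|h (q + t *: dir_u)| <= C * `|t ^+ k|.
Proof.
move=> hO q0 Dq k.
(* The lift of [q] with v = 0; any v would do, since the function factors through [slice_coord]. *)
pose y0 : 'rV[R]_N := row_mx 0 (row_mx q.2 0).
pose gam (t : R) := t *: (delta_mx 0 (@idx_u n) : 'rV[R]_N) + y0.
have Ly0 : slice_coord y0 = q.
  rewrite /slice_coord /coord_u /coord_x !row_mxKr row_mxKl mxE -q0.
  by case: (q).
have Lg t : slice_coord (gam t) = q + t *: dir_u.
  by rewrite /gam slice_coord_linear slice_coord_delta Ly0 addrC.
have cg : {for 0, continuous gam}.
  apply: differentiable_continuous.
  exact: differentiableD (differentiableZl _ (@ex_diff _ _ _ _ _ idfun _ _))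
    (differentiable_cst _ _).
have ug t : coord_u (gam t) = t.
  have /(congr1 fst) := Lg t; rewrite /= => ->.
  by rewrite q0 add0r /GRing.scale /= mulr1.
have xg : D (coord_x (gam 0)).
  by have /(congr1 snd) := Lg 0; rewrite /= => ->; rewrite scaler0 addr0.
have [C C0 nC] := Oinfty_path hO cg xg ug k.
by exists C => //; apply: filterS nC => t; rewrite Lg.
Qed.

End OinftyTransfer.

Section ChartDomain.
Context {R : realType} {n : nat} (M : manifold R n) (i : chart_index M).
Local Notation Q := (R * 'rV[R]_n)%type.

Lemma chart_domain_open (W : set (R * M)) : open W -> open (chart_domain W i).
Proof.
move=> oW; rewrite openE => q [cq Wq].
have cc : nbhs q.2 (ccod (atlas i)) by apply: open_nbhs_nbhs; split => //; exact: ccod_open.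
have cW : {for q, continuous (fun p : Q => (p.1, cinv (atlas i) p.2) : R * M)}.
  have c1 : (fst : Q -> R) @ q --> q.1 by exact: cvg_fst.
  have c2 : cinv (atlas i) p.2 @[p --> q] --> cinv (atlas i) q.2.
    apply: (@cvg_comp _ _ _ snd (cinv (atlas i)) _ (nbhs q.2)); first exact: cvg_snd.
    exact: cinv_cont.
  exact: (cvg_pair c1 c2).
apply: filterI; first exact: (cvg_snd cc).
by apply: cW; exact: open_nbhs_nbhs.
Qed.

(** Congruence of densities is a statement on R * M without charts; near (0, p) the estimate is
    pulled back through a chart around [p]. *)
Lemma Oinfty_chart (h : R -> M -> R) :
  (forall p : M, exists2 i : chart_index M, cdom (atlas i) p &
     Oinfty (fst : Q -> R) [set q | ccod (atlas i) q.2]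
       (fun q => h q.1 (cinv (atlas i) q.2))) ->
  Oinfty (fst : R * M -> R) setT (fun q => h q.1 q.2).
Proof.
move=> hO; apply/OinftyP => -[u p] _ /= -> k; have [j jp /OinftyP jO] := hO p.
have [C C0 nC] := jO (0, cmap (atlas j) p) (cmap_cod jp) erefl k; exists C => //.
have cm : {for (0, p), continuous (fun q : R * M => (q.1, cmap (atlas j) q.2) : Q)}.
  have c1 : (fst : R * M -> R) @ ((0 : R), p) --> (0 : R) by exact: cvg_fst.
  have c2 : cmap (atlas j) q.2 @[q --> ((0 : R), p)] --> cmap (atlas j) p.
    apply: (@cvg_comp _ _ _ snd (cmap (atlas j)) _ (nbhs p)); first exact: cvg_snd.
    exact: cmap_cont.
  exact: (cvg_pair c1 c2).
have dj : nbhs p (cdom (atlas j)) by apply: open_nbhs_nbhs; split => //; exact: cdom_open.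
have dj' : \forall q \near ((0 : R), p), cdom (atlas j) q.2 by exact: (cvg_snd dj).
have nC' := cm _ nC; near=> q.
have dq : cdom (atlas j) q.2 by near: q.
have : `|h q.1 (cinv (atlas j) (cmap (atlas j) q.2))| <= C * `|q.1 ^+ k| by near: q.
by rewrite cmapK.
Unshelve. all: by end_near. Qed.

End ChartDomain.

(** * The Einstein solution *)

Section EinsteinModel.
Context {R : realType} {n : nat}.
Local Notation Q := (R * 'rV[R]_n)%type.
Local Notation dir_u := (@dir_u R n).
Local Notation dir_x := (@dir_x R n).
Implicit Types (q : Q) (i j k l : 'I_n).
Variables (D : set 'rV[R]_n) (G : 'rV[R]_n -> 'M[R]_n) (mu c : R).
Hypothesis oD : open D.
Hypothesis sG : forall i j, smooth_on D (fun x => G x i j).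
Hypothesis symG : forall x, D x -> (G x)^T = G x.
Hypothesis uG : forall x, D x -> G x \in unitmx.
Hypothesis einG : forall x, D x -> ricci G x = (2 * mu) *: G x.

(** For g_u = s g with s depending on u only, Ric (g_u) = 2 mu g, so P_ij = 0 reads s' = 4 mu with s
    = 1 at u = 0. *)
Definition einstein_scale (t : R) : R := 1 + 4 * mu * t.
Local Notation s := einstein_scale.
Definition einstein_metric q : 'M[R]_n := s q.1 *: G q.2.
(** The trace of 1/2 d_u g_u is 2 n mu / s, so F = 0 reads d_u phi_u = n mu / s; integrating s' / s
    = 4 mu / s gives the factor n/4. *)
Definition einstein_density q : R := n%:R / 4 * ln `|s q.1| + c.
Local Notation B := einstein_metric.
Local Notation psi := einstein_density.
Definition einstein_domain : set Q := [set q | D q.2 /\ 0 < s q.1].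
Local Notation U := einstein_domain.

Lemma einstein_scale_smooth (A : set Q) : open A -> smooth_on A (fun q => s q.1).
Proof.
move=> oA; apply: smooth_onD => //; first exact: smooth_on_cst.
apply: smooth_onM => //; first exact: smooth_on_cst.
by apply: smooth_on_linear; [|exact: fst_linear|exact: fst_differentiable].
Qed.

Lemma einstein_domain_open : open U.
Proof.
apply: (@openI _ (snd @^-1` D) ((fun q : Q => s q.1) @^-1` [set t | 0 < t])).
  by apply: open_comp => // q _; exact: cvg_snd.
apply: open_comp; last exact: open_gt.
move=> q _; apply: differentiable_continuous.
exact: (smooth_on_differentiable (einstein_scale_smooth openT)).
Qed.
Local Notation oU := einstein_domain_open.

Lemma snd_smooth (f : 'rV[R]_n -> R) : smooth_on D f -> smooth_on U (fun q => f q.2).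
Proof.
move=> sf; apply: (@smooth_on_subset _ _ _ (snd @^-1` D)) => [q []//|].
apply: (smooth_on_comp_affine (L0 := snd)) sf => //.
exact: snd_differentiable.
Qed.

Lemma entry_sym x : D x -> forall i j, G x i j = G x j i.
Proof. by move=> Dx i j; rewrite -[in LHS](symG Dx) mxE. Qed.

Lemma derive_fst (f : R -> R) q v : 'D_v (fun p : Q => f p.1) q = 'D_(v.1) f q.1.
Proof. exact: (@derive_comp_affine _ _ _ fst fst (@fst_linear R n)). Qed.

Lemma derive_snd (f : 'rV[R]_n -> R) q v : 'D_v (fun p : Q => f p.2) q = 'D_(v.2) f q.2.
Proof. exact: (@derive_comp_affine _ _ _ snd snd (@snd_linear R n)). Qed.

Lemma derive_einstein_scale t : 'D_1 s t = 4 * mu.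
Proof.
rewrite /einstein_scale (_ : (fun t => _) = cst 1 + (4 * mu) *: (id : R -> R)) //.
rewrite deriveD; [|exact: derivable_cst|exact/derivableZ/derivable_id].
rewrite derive_cst deriveZ; last exact: derivable_id.
by rewrite derive_id add0r /GRing.scale /= mulr1.
Qed.

Lemma einstein_metric_smooth i j : smooth_on U (fun q => B q i j).
Proof.
apply: (smooth_on_eq oU (f := fun q => s q.1 * G q.2 i j)).
  by move=> q _; rewrite mxE.
apply: smooth_onM; [exact: oU|exact: einstein_scale_smooth oU|].
exact: (snd_smooth (sG i j)).
Qed.

Lemma einstein_density_smooth : smooth_on U psi.
Proof.
apply: smooth_onD; [exact: oU| |exact: smooth_on_cst oU _].
apply: smooth_onM; [exact: oU|exact: smooth_on_cst oU _|].
apply: (smooth_on_eq oU (f := fun q => ln (s q.1))).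
  by move=> q [_ s0]; rewrite gtr0_norm.
apply: smooth_on_ln; [exact: oU|by move=> q []|exact: einstein_scale_smooth oU].
Qed.

Lemma einstein_metric_unit q : U q -> B q \in unitmx.
Proof. by move=> [Dq s0]; rewrite /B unitmxZ ?uG // unitfE gt_eqF. Qed.

Lemma derive_einstein_metric q i j v : U q ->
  'D_v (fun p => B p i j) q = s q.1 * 'D_(v.2) (fun x => G x i j) q.2
                             + G q.2 i j * 'D_(v.1) s q.1.
Proof.
move=> Uq; rewrite (_ : (fun p => B p i j) = (fun p => s p.1) * (fun p => G p.2 i j)); last first.
  by apply/funext => p; rewrite /einstein_metric mxE.
rewrite deriveM.
- by rewrite derive_fst (derive_snd (fun x => G x i j)).
- exact: (smooth_on_derivable (einstein_scale_smooth oU) Uq).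
- exact: (smooth_on_derivable (snd_smooth (sG i j)) Uq).
Qed.

Lemma derive_einstein_metric_x q i j k : U q ->
  'D_(dir_x k) (fun p => B p i j) q = s q.1 * partial k (fun x => G x i j) q.2.
Proof. by move=> Uq; rewrite derive_einstein_metric // derive0 mulr0 addr0. Qed.

Lemma derive_einstein_metric_u q i j : U q ->
  'D_dir_u (fun p => B p i j) q = 4 * mu * G q.2 i j.
Proof.
by move=> Uq; rewrite derive_einstein_metric // derive0 mulr0 add0r derive_einstein_scale mulrC.
Qed.

Lemma invmx_einstein_metric q i j : U q ->
  invmx (B q) i j = (s q.1)^-1 * invmx (G q.2) i j.
Proof. by move=> Uq; have := einstein_metric_unit Uq; case: Uq => *; rewrite /B invmxZ ?mxE. Qed.

Lemma einstein_christoffel k i j q : U q ->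
  slice_christoffel B k i j q = christoffel G k i j q.2.
Proof.
move=> Uq; congr (_ * _); apply: eq_bigr => l _.
rewrite invmx_einstein_metric // !derive_einstein_metric_x //.
have [_ s0] := Uq; by field; rewrite gt_eqF.
Qed.

Lemma einstein_shape k i q : U q ->
  slice_shape B k i q = 2 * mu / s q.1 * (k == i)%:R.
Proof.
move=> Uq; have [Dq s0] := Uq.
have /matrixP/(_ k i) := mulVmx (uG Dq); rewrite !mxE => <-.
rewrite /slice_shape 2!mulr_sumr; apply: eq_bigr => l _.
rewrite invmx_einstein_metric // derive_einstein_metric_u // (entry_sym Dq i l).
by field; rewrite gt_eqF.
Qed.

Lemma derive_einstein_christoffel a b d v q : U q ->
  'D_v (slice_christoffel B a b d) q = 'D_(v.2) (christoffel G a b d) q.2.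
Proof.
move=> Uq; rewrite -derive_snd; apply: (eq_on_derive oU) => // p Up.
exact: einstein_christoffel.
Qed.

Lemma einstein_ricci i j q : U q -> slice_ricci B i j q = 2 * mu * G q.2 i j.
Proof.
move=> Uq; have [Dq _] := Uq.
have -> : 2 * mu * G q.2 i j = ricci G q.2 i j by rewrite einG // !mxE.
rewrite mxE; apply: eq_bigr => k _.
rewrite !derive_einstein_christoffel //; congr (_ + _); apply: eq_bigr => p _.
by rewrite !einstein_christoffel.
Qed.

Lemma derive_einstein_density v q : v.1 = 0 -> 'D_v psi q = 0.
Proof.
by move=> v0; rewrite (derive_fst (fun t => n%:R / 4 * ln `|s t| + c)) v0 derive0.
Qed.

Lemma derive_einstein_density_u q : U q -> 'D_dir_u psi q = n%:R * mu / s q.1.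
Proof.
move=> Uq; have [_ s0] := Uq.
have E p : U p -> psi p = n%:R / 4 * ln (s p.1) + c.
  by move=> [_ sp]; rewrite /einstein_density gtr0_norm.
have sl : smooth_on U (fun p => ln (s p.1)).
  by apply: smooth_on_ln; [exact: oU|move=> p []|exact: einstein_scale_smooth oU].
rewrite (eq_on_derive oU dir_u E Uq).
rewrite deriveD; [|
  exact: (smooth_on_derivable (smooth_onM oU (smooth_on_cst oU _) sl) Uq)|
  exact: derivable_cst].
rewrite derive_cst addr0 (_ : (fun p : Q => _ * _) = (n%:R / 4) *: (fun p : Q => ln (s p.1))) //.
rewrite deriveZ; last exact: (smooth_on_derivable sl Uq).
have -> : 'D_dir_u (fun p : Q => ln (s p.1)) q = (s q.1)^-1 * 'D_dir_u (fun p : Q => s p.1) q.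
  apply: (@derive_chain _ _ _ (fun p : Q => s p.1)); first exact: is_derive1_ln.
  exact: (smooth_on_differentiable (einstein_scale_smooth oU) Uq).
rewrite derive_fst derive_einstein_scale /GRing.scale /=.
by field; rewrite gt_eqF.
Qed.

Lemma einstein_hessian i j q : slice_hessian B psi i j q = 0.
Proof.
have D0 k : 'D_(dir_x k) psi = cst 0.
  by apply/funext => p; rewrite derive_einstein_density.
rewrite /slice_hessian D0 derive_cst sub0r big1 ?oppr0 // => k _.
by rewrite derive_einstein_density // mulr0.
Qed.

Lemma einstein_P i j q : U q -> slice_P B psi i j q = 0.
Proof.
move=> Uq; rewrite /slice_P einstein_ricci // einstein_hessian derive_einstein_metric_u //.
by field.
Qed.

Lemma einstein_F q : U q -> slice_F B psi q = 0.
Proof.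
move=> Uq; have [Dq s0] := Uq; rewrite /slice_F derive_einstein_density_u //.
have tr : \sum_(i < n) \sum_(j < n) invmx (G q.2) i j * G q.2 i j = n%:R.
  transitivity (\sum_(i < n) (1 : R)); last by rewrite sumr_const card_ord.
  apply: eq_bigr => i _; have /matrixP/(_ i i) := mulVmx (uG Dq).
  rewrite !mxE eqxx /= mulr1n => <-; apply: eq_bigr => j _.
  by rewrite (entry_sym Dq i j).
rewrite [X in _ - X + _]big1 ?subr0; last first.
  by move=> i _; rewrite big1 // => j _; rewrite !derive_einstein_density // mulr0 mulr0.
rewrite (_ : \sum_(i < n) _ = - (2 * mu / s q.1) *
    \sum_(i < n) \sum_(j < n) invmx (G q.2) i j * G q.2 i j).
  by rewrite tr; field; rewrite gt_eqF.
rewrite mulr_sumr; apply: eq_bigr => i _; rewrite mulr_sumr; apply: eq_bigr => j _.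
rewrite einstein_hessian derive_einstein_metric_u // invmx_einstein_metric //.
by field; rewrite gt_eqF.
Qed.

Lemma einstein_christoffel_sym k i j q : U q ->
  slice_christoffel B k i j q = slice_christoffel B k j i q.
Proof.
move=> Uq; congr (_ * _); apply: eq_bigr => l _; congr (_ * (_ - _)).
  exact: addrC.
by apply: (eq_on_derive oU) => // p [Dp _]; rewrite !mxE (entry_sym Dp i j).
Qed.

Lemma derive_einstein_shape k i v q : U q ->
  'D_v (slice_shape B k i) q =
  - (2 * mu * (k == i)%:R / s q.1 ^+ 2) * 'D_(v.1) s q.1.
Proof.
move=> Uq; have [_ s0] := Uq.
have s_neq0 : s q.1 != 0 by rewrite gt_eqF.
have ds := smooth_on_derivable (v := v) (einstein_scale_smooth oU) Uq.
pose a := 2 * mu * (k == i)%:R.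
have E p : U p -> slice_shape B k i p = (a *: (fun p : Q => (s p.1)^-1)) p.
  by move=> Up; rewrite einstein_shape // /GRing.scale /= mulrAC.
rewrite (eq_on_derive oU v E Uq) deriveZ; last exact: derivableV.
by rewrite deriveV // derive_fst /GRing.scale /= /a mulrA mulrN.
Qed.

Lemma derive_einstein_density_u_v v q : U q ->
  'D_v ('D_dir_u psi) q = - (n%:R * mu / s q.1 ^+ 2) * 'D_(v.1) s q.1.
Proof.
move=> Uq; have [_ s0] := Uq.
have s_neq0 : s q.1 != 0 by rewrite gt_eqF.
have ds := smooth_on_derivable (v := v) (einstein_scale_smooth oU) Uq.
have E p : U p -> 'D_dir_u psi p = ((n%:R * mu) *: (fun p : Q => (s p.1)^-1)) p.
  by move=> Up; rewrite derive_einstein_density_u.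
rewrite (eq_on_derive oU v E Uq) deriveZ; last exact: derivableV.
by rewrite deriveV // derive_fst /GRing.scale /= mulrA mulrN.
Qed.

(** The components with a v vanish identically, and the tangential ones are [einstein_P]. In the
    mixed ones the shape operator 2 mu / s times the identity does not depend on x, nor do the
    Christoffel symbols depend on u, so only two contracted Christoffel sums remain, and they
    cancel. In the uu component the Ricci term balances the second u-derivative of the density. *)
Lemma einstein_ambient_P y a b : U (slice_coord y) ->
  weightedP (fun y => ambient_mx (B (slice_coord y)))
    (fun y => psi (slice_coord y) - coord_v y) 0 y a b = 0.
Proof.
move=> Uy; set q := slice_coord y in Uy *.
have [Dq s0] := Uy.
have E (f : 'rV[R]_(1 + (n + 1)) -> 'M[R]_(1 + (n + 1))) h a' b' :
    weightedP f h 0 y a' b' = ricci f y a' b' + hessian f h y a' b'.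
  by rewrite /weightedP scale0r subr0 mxE.
have sum_delta (r : R) (F : 'I_n -> R) k :
    \sum_p F p * (r * (p == k)%:R) = F k * r.
  rewrite (bigD1 k) //= eqxx mulr1 big1 ?addr0 // => p /negbTE ->.
  by rewrite !mulr0.
have gradpsi0 i : \sum_(k < n) slice_shape B k i q * 'D_(dir_x k) psi q = 0.
  by rewrite big1 // => k _; rewrite derive_einstein_density // mulr0.
rewrite E; move: a b.
apply: idx_ind => [b|i|]; first by rewrite ricci_ambient hessian_ambient addr0.
- apply: idx_ind => [|j|]; first by rewrite ricci_ambient hessian_ambient addr0.
  + have := weightedP_ambient B psi y i j; rewrite einstein_P // => <-.
    by rewrite E.
  + rewrite ricci_ambient hessian_ambient -/q derive_einstein_density_u_v // derive0 mulr0.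
    rewrite gradpsi0 subrr addr0 big1 // => k _.
    rewrite !derive_einstein_shape // derive0 !mulr0 subrr add0r sumrB.
    under eq_bigr do rewrite einstein_shape //.
    under [X in _ - X]eq_bigr do rewrite einstein_shape //.
    by rewrite !sum_delta einstein_christoffel_sym // subrr.
- apply: idx_ind => [|i|]; first by rewrite ricci_ambient hessian_ambient addr0.
  + rewrite ricci_ambient hessian_ambient -/q gradpsi0 subr0.
    rewrite (_ : 'D_(dir_x i) psi = cst 0); last first.
      by apply/funext => p; rewrite derive_einstein_density.
    rewrite derive_cst addr0 big1 // => k _.
    rewrite derive_einstein_shape // derive_einstein_christoffel // !derive0 mulr0 subrr add0r.
    rewrite sumrB; under eq_bigr do rewrite einstein_shape //.
    under [X in _ - X]eq_bigr do rewrite einstein_shape // mulrC eq_sym.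
    by rewrite !sum_delta subrr.
  + rewrite ricci_ambient hessian_ambient -/q derive_einstein_density_u_v //.
    (* Each direction of M contributes 8 mu^2 / s^2 from minus the derivative of the shape operator
       and -4 mu^2 / s^2 from its square; the n copies of 4 mu^2 / s^2 cancel against psi'' = -4 n
       mu^2 / s^2. *)
    rewrite derive_einstein_scale (_ : \sum_(k < n) _ = \sum_(k < n) (4 * mu ^+ 2 / s q.1 ^+ 2)).
      rewrite sumr_const card_ord -mulr_natl; field; by rewrite gt_eqF.
    apply: eq_bigr => k _; rewrite derive_einstein_shape // derive_einstein_scale eqxx.
    under eq_bigr do rewrite !einstein_shape // [k == _]eq_sym.
    rewrite sum_delta eqxx /= !mulr1; field; by rewrite gt_eqF.
Qed.


End EinsteinModel.

(** * Continuity, openness and derivatives of powers of 1 + 4 mu u *)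

Lemma iter_derive_cst0 (R : realType) (V : normedModType R) (e : V) j :
  iter j (fun h : V -> R => 'D_e h) (cst 0) = cst 0.
Proof.
by elim: j => // j IH; rewrite iterS IH; apply/funext => x; exact: derive_cst.
Qed.

Lemma open_pos_smooth (R : realType) (V : normedModType R) (U : set V) (f : V -> R) :
  open U -> smooth_on U f -> open (U `&` [set x | 0 < f x]).
Proof.
move=> oU sf; rewrite openE => x [Ux fx]; apply: filterI.
  by apply: open_nbhs_nbhs.
have cf := differentiable_continuous (smooth_on_differentiable sf Ux).
have /nbhs_ballP[e e0 eP] : nbhs (f x) [set t : R | 0 < t].
  by apply: open_nbhs_nbhs; split => //; exact: open_gt.
apply: (@filterS _ (nbhs x) _ _ _ _ (cf _ (nbhsx_ballx (f x) e e0))) => y /=.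
exact: eP.
Qed.

Lemma slice_coord_continuous (R : realType) n : continuous (@slice_coord R n).
Proof.
move=> y.
have c1 : (@coord_u R n) z @[z --> y] --> coord_u y.
  apply: differentiable_continuous.
  apply: (@differentiable_comp _ _ _ _
    (fun z : 'rV[R]_(1 + (n + 1)) => rsubmx (rsubmx z)) (fun z => z 0 0)).
    apply: (@differentiable_comp _ _ _ _ rsubmx rsubmx); exact: differentiable_rsubmx.
  exact: differentiable_coord.
have c2 : (@coord_x R n) z @[z --> y] --> coord_x y.
  apply: differentiable_continuous.
  apply: (@differentiable_comp _ _ _ _ rsubmx lsubmx).
    exact: differentiable_rsubmx.
  exact: differentiable_lsubmx.
exact: (cvg_pair c1 c2).
Qed.

Lemma differentiable_scale (R : realType) (mu t : R) : differentiable (einstein_scale mu) t.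
Proof.
apply: differentiableD; first exact: differentiable_cst.
exact: (@differentiableZ _ _ _ idfun (4 * mu) t (@ex_diff _ _ _ _ _ idfun _ _)).
Qed.

Lemma derive_powR_scale (R : realType) (mu a : R) (t : R) :
  0 < einstein_scale mu t ->
  'D_1 (fun t => einstein_scale mu t `^ a) t =
  4 * mu * a * einstein_scale mu t `^ (a - 1).
Proof.
move=> s0.
have ds := differentiable_scale mu t.
rewrite (derive_chain (1 : R) (is_derive1_powR a s0) ds) derive_einstein_scale; ring.
Qed.

Lemma open_scale_gt0 (R : realType) (mu : R) : open [set t : R | 0 < einstein_scale mu t].
Proof.
apply: (@open_comp _ _ (einstein_scale mu) [set t | 0 < t]); last exact: open_gt.
by move=> t _; exact/differentiable_continuous/differentiable_scale.
Qed.

Lemma iter_derive_powR_scale (R : realType) (mu a : R) (k : nat) (t : R) :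
  0 < einstein_scale mu t ->
  iter k (fun f : R -> R => 'D_1 f) (fun t : R => einstein_scale mu t `^ a) t =
  (4 * mu) ^+ k * (\prod_(0 <= j < k) (a - j%:R)) * einstein_scale mu t `^ (a - k%:R).
Proof.
pose A := [set t : R | 0 < einstein_scale mu t].
have oA : open A by exact: open_scale_gt0.
elim: k t => [|k IH] t s0.
  by rewrite expr0 big_geq // !mul1r subr0.
rewrite iterS (eq_on_derive oA (1 : R) IH s0).
rewrite (_ : (fun t => _) = ((4 * mu) ^+ k * (\prod_(0 <= j < k) (a - j%:R))) *:
  (fun t => einstein_scale mu t `^ (a - k%:R))) //.
rewrite deriveZ.
  rewrite derive_powR_scale // /GRing.scale /= big_nat_recr //= exprS.
  rewrite -addrA -opprD natr1; ring.
apply: diff_derivable.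
rewrite -[fun t0 => _]/((fun z : R => z `^ (a - k%:R)) \o einstein_scale mu).
apply: differentiable_comp; first exact: differentiable_scale.
exact/derivable1_diffP/(@ex_derive _ _ _ _ _ _ _ (is_derive1_powR (a - k%:R) s0)).
Qed.

(** One factor 4 of (4 mu)^k goes into each factor of the falling product for the exponent n/4; this
    is the origin of the factors n - 4 j. *)
Lemma prod_falling_quarter (R : realType) (mu a : R) (k : nat) :
  (4 * mu) ^+ k * \prod_(0 <= j < k) (a / 4 - j%:R) =
  mu ^+ k * \prod_(0 <= j < k) (a - 4 * j%:R).
Proof.
elim: k => [|k IH]; first by rewrite !big_geq // !mulr1.
rewrite !big_nat_recr //= !exprS; set A := \prod_(0 <= j < k) _ in IH *.
set b := \prod_(0 <= j < k) _ in IH *.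
rewrite (_ : _ * (A * _) = (4 * mu) ^+ k * A * (mu * (a - 4 * k%:R))).
  by rewrite IH; ring.
by field.
Qed.

(** * Normal ambient metrics over an Einstein manifold, in a chart *)

Section NormalAmbientChart.
Context {R : realType} {n : nat} (M : manifold R n).
Local Notation Q := (R * 'rV[R]_n)%type.
Local Notation dir_u := (@dir_u R n).
Variables (g : tensor_field M) (phi : M -> R) (mu c : R).
Hypothesis g_metric : is_metric g.
Hypothesis g_einstein : forall i x, ccod (atlas i) x -> ricci (g i) x = (2 * mu) *: g i x.
Hypothesis phi_const : forall p, phi p = c.

Section Uniqueness.
Variables (W : set (R * M)) (gu : R -> tensor_field M) (phiu : R -> M -> R).
Hypothesis normal : is_normal_ambient g phi 0 W gu phiu.
Variable i : chart_index M.
Local Notation D := (ccod (atlas i)).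
Local Notation B := (fun q : Q => gu q.1 i q.2).
Local Notation psi := (fun q : Q => phiu q.1 (cinv (atlas i) q.2)).
Local Notation BE := (einstein_metric (g i) mu).
Local Notation psiE := (@einstein_density R n mu c).
Local Notation UE := (einstein_domain D mu).

(** A single [U] serves all orders. It is cut out of the domain of the given metric by two
    positivity conditions, on 1 + 4 mu u for the model and on the ratio of determinants for the
    later logarithm; both quantities equal 1 at u = 0, so the slice survives. *)
Lemma normal_ambient_cong : exists U : set Q,
  [/\ open U, U `<=` UE, (forall x, D x -> U (0, x)),
      (forall q, U q -> 0 < \det (B q) / \det (g i q.2)) &
      forall k, (forall a b,
          cong U (fst : Q -> R) dir_u k (fun q => B q a b) (fun q => BE q a b)) /\
        cong U (fst : Q -> R) dir_u k psi psiE].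
Proof.
have [oW W0 fam sphi g0 phi0 nP nF] := normal.
have [sB symB uB _] := fam.
have oD : open D := @ccod_open _ _ _ (atlas i).
have sG a b : smooth_on D (fun x => g i x a b)  by exact: metric_smooth.
have uG x : D x -> g i x \in unitmx  by exact: metric_nondeg.
have symG x : D x -> (g i x)^T = g i x  by exact: Defs.metric_sym.
have oUE : open UE := einstein_domain_open (mu := mu) oD.
pose U1 := chart_domain W i `&` UE.
have oU1 : open U1 by apply: openI => //; exact: chart_domain_open.
pose ratio (q : Q) := \det (B q) / \det (g i q.2).
have sB1 a b : smooth_on U1 (fun q => B q a b).
  by apply: smooth_on_subset (sB i a b) => q [].
have sG1 a b : smooth_on U1 (fun q => g i q.2 a b).
  apply: (@smooth_on_subset _ _ _ UE); first by move=> q [].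
  exact: (snd_smooth (sG a b)).
have detG0 (q : Q) : D q.2 -> \det (g i q.2) != 0.
  by move=> /uG; rewrite unitmxE unitfE.
have sratio : smooth_on U1 ratio.
  (* Smoothness of a determinant is again read off from a congruence of order 0. *)
  have sdet (A : Q -> 'M[R]_n) : (forall a b, smooth_on U1 (fun q => A q a b)) ->
      smooth_on U1 (fun q => \det (A q)).
    move=> sA.
    have cA a b : cong U1 (fst : Q -> R) dir_u 0 (fun q => A q a b) (fun q => A q a b).
      exact: cong_refl (sA a b).
    by have [] := cong_det oU1 cA.
  apply: smooth_onM => //; first exact: sdet.
  apply: smooth_onV => //; last exact: sdet.
  by move=> q [_ [/detG0]].
pose U := U1 `&` [set q | 0 < ratio q].
have oU : open U := open_pos_smooth oU1 sratio.
have sub (f : Q -> R) : smooth_on U1 f -> smooth_on U f.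
  by apply: smooth_on_subset => q [].
have subE (f : Q -> R) : smooth_on UE f -> smooth_on U f.
  by apply: smooth_on_subset => q [[]].
exists U; split=> //.
- by move=> q [[]].
- move=> x Dx; split; first split.
  + by split=> //=; exact: W0.
  + by split=> //=; rewrite /einstein_scale mulr0 addr0.
  + by rewrite /= /ratio /= g0 // divff // (detG0 (0, x)).
- by move=> q [].
have uBU q : U q -> B q \in unitmx by case: q => u x [[cq _] _]; exact: uB.
have uBE q : U q -> BE q \in unitmx.
  by move=> [[_ Eq] _]; exact: (einstein_metric_unit uG Eq).
have sBU a b : smooth_on U (fun q => B q a b) by exact/sub/sB1.
have sBEU a b : smooth_on U (fun q => BE q a b).
  by apply/subE/einstein_metric_smooth.
have spsi : smooth_on U psi.
  by apply: smooth_on_subset (sphi i) => q [[]].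
have spsiE : smooth_on U psiE.
  apply: subE; exact: einstein_density_smooth.
(* The bridge from estimates to jets: the error of the given solution is [O(u^oo)], hence has zero
   jet, and the error of the model is zero on its domain. *)
have jet0 k (h hE : Q -> R) : smooth_on U h -> (forall q, UE q -> hE q = 0) ->
    Oinfty (@coord_u R n) [set y | D (coord_x y)] (fun y => h (slice_coord y)) ->
    jet_eq U (fst : Q -> R) dir_u k h hE.
  move=> sh hE0 hO; apply: (@jet_eq_on _ _ _ _ _ oU _ h (cst 0)) => //.
    by move=> q [[_ Eq] _]; rewrite hE0.
  apply/jet_eqP => j _ q Uq q0; rewrite iter_derive_cst0.
  apply: (bigO_iter_derive0 oU sh Uq); apply: (Oinfty_slice_line hO q0).
  by have [[_ []]] := Uq.
have densE : ambient_density_in phiu 0 i =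
    fun y => psi (slice_coord y) - coord_v y.
  by apply/funext => y; rewrite /ambient_density_in /ambient_density !mul0r addr0.
apply: cong_solution => //.
- move=> [u x] [[[Dx _] _] _] /= ->; rewrite g0 // /einstein_metric /einstein_scale /=.
  by rewrite mulr0 addr0 scale1r.
- move=> [u x] [[[Dx _] _] _] /= ->; rewrite phi0 phi_const /einstein_density /einstein_scale /=.
  by rewrite mulr0 addr0 normr1 ln1 mulr0 add0r.
- move=> k a b; apply: jet0.
  + exact: slice_P_smooth.
  + by move=> q Eq; apply: (@einstein_P R n D (g i) mu c) => //; exact: g_einstein.
  + have := nP i (idx_x a) (idx_x b); rewrite densE.
    by rewrite (_ : (fun y => weightedP _ _ _ y _ _) =
                    fun y => slice_P B psi a b (slice_coord y)) //;
      apply/funext => y; exact: (weightedP_ambient B psi).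
- move=> k; apply: jet0.
  + exact: slice_F_smooth.
  + by move=> q Eq; exact: (@einstein_F R n D (g i) mu c).
  + have := nF i; rewrite densE.
    by rewrite (_ : weightedF _ _ _ = fun y => slice_F B psi (slice_coord y)) //;
      apply/funext => y; exact: (weightedF_ambient B psi).
Qed.

(** The way back from jets to estimates, applied to the difference: its jet vanishes to every order,
    and [U] is a neighborhood of each point of the slice. *)
Lemma cong_Oinfty (U : set Q) (h hE : Q -> R) : open U ->
  (forall x, D x -> U (0, x)) -> (forall k, cong U (fst : Q -> R) dir_u k h hE) ->
  Oinfty (fst : Q -> R) [set q | D q.2] (fun q => h q - hE q).
Proof.
move=> oU U0 ch; apply/OinftyP => q Dq q0 k.
have Uq : U q by case: q Dq q0 => u x /= Dx ->; exact: U0.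
have [sh shE _] := ch k.
have [sd _ jd] := congB oU (ch k) (cong_refl _ dir_u k shE).
apply: (jet0_bigO (e := dir_u) oU (@fst_linear R n) (@fst_differentiable R n)) => //.
by apply: (jet_eq_on oU _ _ jd) => // p _; rewrite subrr.
Qed.

Lemma normal_ambient_metric a b :
  Oinfty (fst : Q -> R) [set q | D q.2] (fun q => B q a b - BE q a b).
Proof.
have [U [oU _ U0 _ cU]] := normal_ambient_cong.
by apply: (cong_Oinfty oU U0 (h := fun q => B q a b)) => k; have [cB _] := cU k.
Qed.

Lemma normal_ambient_density :
  Oinfty (fst : Q -> R) [set q | D q.2] (fun q => psi q - psiE q).
Proof.
have [U [oU _ U0 _ cU]] := normal_ambient_cong.
by apply: (cong_Oinfty oU U0 (h := psi)) => k; have [_ cpsi] := cU k.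
Qed.

(** The volume depends on the ambient pair through operations that preserve congruence, so its
    Taylor coefficients are those of the model volume (1 + 4 mu u)^(n/4). *)
Lemma normal_ambient_volume_derive (k : nat) x : D x ->
  derive1n k (renormalized_volume g phi 0 gu phiu i 0 x) 0 =
  mu ^+ k * \prod_(0 <= j < k) (n%:R - 4 * j%:R).
Proof.
move=> Dx; have [U [oU UUE U0 rpos cU]] := normal_ambient_cong.
pose vol (q : Q) := expR (- psi q) / expR (- c) * Num.sqrt (\det (B q) / \det (g i q.2)).
have -> : renormalized_volume g phi 0 gu phiu i 0 x = fun u => vol (u, x).
  apply/funext => u; rewrite /renormalized_volume /ambient_density /vol /= phi_const.
  by rewrite !mulr0 addr0 subr0.
(* Iterated derivatives in the real variable u become iterated derivatives on R * R^n along [dir_u],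
   the form in which jets are compared; u |-> (u, x) is affine with linear part u |-> (u, 0). *)
have -> h : derive1n k (fun u : R => h (u, x)) 0 =
    iter k (fun f : Q -> R => 'D_dir_u f) h (0, x) :> R.
  elim: k h => // k IH h; rewrite derive1Sn iterSr -IH; congr (derive1n k _ 0).
  apply/funext => u; rewrite derive1E.
  apply: (@derive_comp_affine _ _ _ (fun u : R => (u, x) : Q) (fun u : R => (u, 0) : Q)).
  move=> a s t; congr (_, _); exact/esym/(etrans (congr1 (+%R^~ x) (scaler0 _ a)) (add0r x)).
pose volE (q : Q) := einstein_scale mu q.1 `^ (n%:R / 4).
(* Order k+1, because a congruence of order k compares derivatives only up to k - 1. *)
have cvol : cong U (fst : Q -> R) dir_u k.+1 vol volE.
  have [cB cpsi] := cU k.+1.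
  have detBE q : U q -> \det (BE q) / \det (g i q.2) = einstein_scale mu q.1 ^+ n.
    move=> Uq; rewrite /einstein_metric detZ mulfK //.
    have [Dq _] := UUE _ Uq; rewrite -unitfE -unitmxE; exact: metric_nondeg.
  have cG : cong U (fst : Q -> R) dir_u k.+1
      (fun q => (\det (g i q.2))^-1) (fun q => (\det (g i q.2))^-1).
    apply: cong_refl; apply: (@smooth_on_subset _ _ _ UE) => //.
    have oUE : open UE by apply: einstein_domain_open; exact: ccod_open.
    apply: smooth_onV => //.
      move=> q [Dq _]; rewrite -unitfE -unitmxE; exact: metric_nondeg.
    have cA a b : cong UE (fst : Q -> R) dir_u 0 (fun q => g i q.2 a b) (fun q => g i q.2 a b).
      apply: cong_refl; apply: (snd_smooth (f := fun x => g i x a b)).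
      exact: metric_smooth.
    by have [] := cong_det oUE cA.
  have cr : cong U (fst : Q -> R) dir_u k.+1 (fun q => \det (B q) / \det (g i q.2))
      (fun q => einstein_scale mu q.1 ^+ n).
    apply: (cong_on oU _ _ (congM oU (cong_det oU cB) cG)) => //.
  have spos q : U q -> 0 < einstein_scale mu q.1 by move=> /UUE[].
  have cl := cong_ln oU rpos (fun q Uq => exprn_gt0 n (spos q Uq)) cr.
  (* The volume is exp (c - psi + 1/2 ln ratio): the square root becomes half a logarithm, so
     congruence for [expR] and [ln] suffices. *)
  have := cong_expR oU (congD oU (congB oU (cong_cst _ _ oU k.+1 c) cpsi)
    (congM oU (cong_cst _ _ oU k.+1 2^-1) cl)).
  apply: (cong_on oU) => q Uq.
    rewrite /vol -powR12_sqrt ?ltW ?rpos // /powR (gt_eqF (rpos q Uq)).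
    by rewrite -expRN opprK -!expRD [- _ + c]addrC.
  (* For the model the exponent is (-n/4 + n/2) ln s = n/4 ln s, and the constant c cancels. *)
  rewrite /volE /powR gt_eqF ?spos // /einstein_density gtr0_norm ?spos //.
  rewrite lnXn ?spos //; congr expR; rewrite -mulr_natl /cst; by field.
have [_ _ /jet_eqP/(_ k (leqnn _) _ (U0 x Dx) erefl) ->] := cvol.
have E h q : iter k (fun f : Q -> R => 'D_dir_u f) (fun q : Q => h q.1) q =
    iter k (fun f : R -> R => 'D_1 f) h q.1.
  elim: (k) h => // k' IH h; rewrite !iterSr -(IH ('D_1 h)).
  apply: (congr1 (fun F => iter k' (fun f : Q -> R => 'D_dir_u f) F q)).
  by apply/funext => p; rewrite derive_fst.
rewrite (E (fun t => einstein_scale mu t `^ (n%:R / 4))) iter_derive_powR_scale /=;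
  last by rewrite /einstein_scale mulr0 addr0.
rewrite /einstein_scale mulr0 addr0 powR1 mulr1.
exact: prod_falling_quarter.
Qed.

End Uniqueness.

(** On the domain 1 + 4 mu u > 0 the metric stays nondegenerate and the density smooth. Near every
    point of the slice P and F vanish identically, which is stronger than the required [O(u^oo)]. *)
Lemma einstein_is_normal_ambient :
  is_normal_ambient g phi 0 [set q : R * M | 0 < einstein_scale mu q.1]
    (fun u i x => einstein_scale mu u *: g i x)
    (fun u _ => n%:R / 4 * ln `|einstein_scale mu u| + c).
Proof.
set W := [set q : R * M | _].
have oD (i : chart_index M) : open (ccod (atlas i)) := @ccod_open _ _ _ (atlas i).
have sG i a b : smooth_on (ccod (atlas i)) (fun x => g i x a b) by exact: metric_smooth.
have symG i x : ccod (atlas i) x -> (g i x)^T = g i x by exact: Defs.metric_sym.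
have uG i x : ccod (atlas i) x -> g i x \in unitmx by exact: metric_nondeg.
have near_domain (i : chart_index M) (y : 'rV[R]_(1 + (n + 1))) :
    ccod (atlas i) (coord_x y) -> coord_u y = 0 ->
    \forall z \near y, einstein_domain (ccod (atlas i)) mu (slice_coord z).
  move=> Dy uy; apply: (@slice_coord_continuous R n y).
  apply: open_nbhs_nbhs; split; first exact: einstein_domain_open.
  by split=> //=; rewrite uy /einstein_scale mulr0 addr0.
have densE i : ambient_density_in (fun u (_ : M) => n%:R / 4 * ln `|einstein_scale mu u| + c) 0 i =
    fun y => @einstein_density R n mu c (slice_coord y) - coord_v y.
  by apply/funext => y; rewrite /ambient_density_in /ambient_density !mul0r addr0.
have domE i : chart_domain W i = einstein_domain (ccod (atlas i)) mu by [].
split.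
- apply: (@open_comp _ _ fst [set t | 0 < einstein_scale mu t]).
    by move=> q _; exact: cvg_fst.
  exact: open_scale_gt0.
- by move=> p; rewrite /W /= /einstein_scale mulr0 addr0.
- split.
  + move=> i a b; rewrite domE.
    exact: (@einstein_metric_smooth R n (ccod (atlas i)) (g i) mu (oD i) (sG i) a b).
  + by move=> i u x [Dx _]; rewrite linearZ /= symG.
  + move=> i u x xW; exact: (@einstein_metric_unit R n (ccod (atlas i)) (g i) mu (@uG i) (u, x) xW).
  + move=> i j u x _ ov; rewrite /tensor_compat (metric_compat g_metric ov).
    by rewrite -scalemxAr -scalemxAl.
- move=> i; rewrite domE; exact: (@einstein_density_smooth R n (ccod (atlas i)) mu c (oD i)).
- by move=> i x _; rewrite /einstein_scale mulr0 addr0 scale1r.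
- by move=> p; rewrite phi_const /einstein_scale mulr0 addr0 normr1 ln1 mulr0 add0r.
- move=> i a b; apply: Oinfty_near0 => y Dy uy.
  apply: filterS (near_domain i y Dy uy) => z Uz; rewrite densE.
  apply: (@einstein_ambient_P R n (ccod (atlas i)) (g i) mu c) => //.
  + exact: symG.
  + exact: uG.
  + exact: g_einstein.
- move=> i; apply: Oinfty_near0 => y Dy uy.
  apply: filterS (near_domain i y Dy uy) => z Uz; rewrite densE.
  transitivity (slice_F (einstein_metric (g i) mu) (@einstein_density R n mu c) (slice_coord z)).
    exact: weightedF_ambient.
  by apply: (@einstein_F R n (ccod (atlas i)) (g i) mu c) => // x; [exact: symG|exact: uG].
Qed.

End NormalAmbientChart.

Theorem theorem1p3 (R : realType) (n : nat) (M : manifold R n)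
    (g : tensor_field M) (phi : M -> R) (mu c : R)
    (g_metric : is_metric g)
    (g_einstein : forall i x, ccod (atlas i) x ->
       ricci (g i) x = (2 * mu) *: g i x)
    (phi_const : forall p, phi p = c) :
  let gE : R -> tensor_field M :=
    fun u i x => (1 + 4 * mu * u) *: g i x in
  let phiE : R -> M -> R :=
    fun u _ => n%:R / 4 * ln `|1 + 4 * mu * u| + c in
  (exists W : set (R * M), is_normal_ambient g phi 0 W gE phiE) /\
  forall (W : set (R * M)) (gu : R -> tensor_field M) (phiu : R -> M -> R),
    is_normal_ambient g phi 0 W gu phiu ->
    [/\ metrics_eq_mod gu gE,
        densities_eq_mod phiu phiE &
        forall (k : nat) (i : chart_index M) (x : 'rV[R]_n),
          (1 <= k)%N -> ccod (atlas i) x ->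
          renormalized_volume_coef g phi 0 gu phiu k i x =
            (k`!%:R)^-1 * mu ^+ k *
            \prod_(0 <= j < k) (n%:R - 4 * j%:R)].
Proof.
move=> gE phiE; split.
  exists [set q : R * M | 0 < einstein_scale mu q.1].
  exact: einstein_is_normal_ambient.
move=> W gu phiu normal; split.
- by move=> i a b; exact: (normal_ambient_metric g_metric g_einstein phi_const normal).
- apply: (Oinfty_chart (h := fun u p => phiu u p - phiE u p)) => p.
  have [i ip] := atlas_cover p; exists i => //.
  exact: (normal_ambient_density g_metric g_einstein phi_const normal).
- move=> k i x _ Dx; rewrite /renormalized_volume_coef.
  rewrite (normal_ambient_volume_derive g_metric g_einstein phi_const normal k Dx).
  by rewrite mulrA.
Qed.
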